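(* Let $\varphi(s)=c_0s+c_1$ with $c_0\ge2$ an integer and $c_1\in\mathbb C$, $\mathrm{Re}(c_1)\ge0$. Then the composition operator $C_\varphi$ on $\mathcal H^2$ has the double commutant property.
   Context: $\mathcal H^2$ is the Hilbert space of Dirichlet series $f(s)=\sum_{n\ge1}a_nn^{-s}$ with $\|f\|=(\sum|a_n|^2)^{1/2}<\infty$ (analytic on $\{\mathrm{Re}\,s>1/2\}$), and $C_\varphi f=f\circ\varphi$. For a set $\mathcal A\subset\mathcal B(H)$ of bounded operators on a Hilbert space $H$, $\mathcal A'=\{T\in\mathcal B(H):TA=AT\ \text{for all }A\in\mathcal A\}$ and $\mathcal A''=(\mathcal A')'$. For $A\in\mathcal B(H)$, $\mathrm{alg}(A)=\{p(A):p\text{ a polynomial}\}$, and $A$ has the double commutant property if $\overline{\mathrm{alg}(A)}^{\sigma}=\{A\}''$, where $\sigma$ denotes the weak operator topology. *)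

(* Defs.v *)
From HB Require Import structures.
From mathcomp Require Import all_boot all_order all_algebra.
From mathcomp Require Import complex.
From mathcomp Require Import all_classical all_reals all_analysis.

Set Implicit Arguments.
Unset Strict Implicit.
Unset Printing Implicit Defensive.

Import Order.TTheory GRing.Theory Num.Theory.
Import numFieldNormedType.Exports.
Import Normc.

Local Open Scope classical_set_scope.
Local Open Scope complex_scope.
Local Open Scope ring_scope.

Section BoundedOperators.
Variables (R : realType) (H : normedModType R[i]).

Record bounded_operator := BoundedOperator {
  bop_linear :> {linear H -> H};
  bop_bounded : bounded_near bop_linear (nbhs (0 : H)) }.

HB.instance Definition _ := gen_eqMixin bounded_operator.
HB.instance Definition _ := gen_choiceMixin bounded_operator.

Definition commutant (A : set bounded_operator) : set bounded_operator :=
  [set T | forall S, A S -> forall x, T (S x) = S (T x)].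

Definition poly_alg (A : bounded_operator) : set bounded_operator :=
  [set T | exists p : {poly R[i]},
     forall x, T x = \sum_(i < size p) p`_i *: iter i A x].

(* [R[i]^o] is [R[i]] with the topology of its modulus.
   The space [H] carries only a norm; the inner product [dot] that turns it
   into a Hilbert space is a parameter. *)
Variable dot : H -> H -> R[i]^o.

Definition matrix_coefs (T : bounded_operator) : {ptws H * H -> R[i]^o} :=
  fun xy => dot (T xy.1) xy.2.

(* Initial topology of the maps [T |-> dot (T x) y], for [x y : H]. *)
Definition weak_operator_topology := initial_topology matrix_coefs.

Definition double_commutant_property (A : bounded_operator) :=
  closure (poly_alg A : set weak_operator_topology) =
  commutant (commutant [set A]).

End BoundedOperators.

Section SquareSummable.
Variable R : realType.
Implicit Types a b : nat -> R[i]^o.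

Definition sqnorms a : R^nat := fun n => normc (a n) ^+ 2.

Definition square_summable : {pred nat -> R[i]^o} :=
  mem [set a | cvgn (series (sqnorms a))].

Definition l2norm a : R := Num.sqrt (limn (series (sqnorms a))).

Lemma sqnorms_ge0 a n : 0 <= sqnorms a n.
Proof. exact: sqr_ge0. Qed.

Lemma nondecreasing_sqnorms a :
  {homo series (sqnorms a) : m n / (m <= n)%N >-> m <= n}.
Proof. by apply: nondecreasing_series => i _ _; exact: sqnorms_ge0. Qed.

Lemma series_sqnorms_ge0 a n : 0 <= series (sqnorms a) n.
Proof. by apply: sumr_ge0 => i _; exact: sqnorms_ge0. Qed.

Lemma square_summableP a :
  reflect (cvgn (series (sqnorms a))) (a \in square_summable).
Proof. by apply: (iffP idP); rewrite inE. Qed.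

Lemma le_series_l2norm a n : cvgn (series (sqnorms a)) ->
  series (sqnorms a) n <= l2norm a ^+ 2.
Proof.
move=> ca; have h : series (sqnorms a) n <= limn (series (sqnorms a)).
  exact: (nondecreasing_cvgn_le (@nondecreasing_sqnorms a) ca n).
by rewrite sqr_sqrtr// (le_trans _ h)// series_sqnorms_ge0.
Qed.

Lemma l2norm_le a (M : R) : 0 <= M ->
  (forall n, series (sqnorms a) n <= M ^+ 2) ->
  cvgn (series (sqnorms a)) /\ l2norm a <= M.
Proof.
move=> M0 aM; have ca : cvgn (series (sqnorms a)).
  apply: nondecreasing_is_cvgn; first exact: nondecreasing_sqnorms.
  by exists (M ^+ 2) => _ [n _ <-]; exact: aM.
split => //.
rewrite -[leRHS]ger0_norm// -sqrtr_sqr ler_wsqrtr//.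
by apply: limr_le => //; exact: nearW.
Qed.

Lemma sqrt_series_sqnormsD a b n :
  Num.sqrt (series (sqnorms (a + b)) n) <=
  Num.sqrt (series (sqnorms a) n) + Num.sqrt (series (sqnorms b) n).
Proof.
have step c m : Num.sqrt (series (sqnorms c) m.+1) =
    normc (Num.sqrt (series (sqnorms c) m) +i* normc (c m)).
  by rewrite /= sqr_sqrtr ?series_sqnorms_ge0// seriesSr.
elim: n => [|n IHn]; first by rewrite !seriesEnat /= !big_geq// sqrtr0 addr0.
rewrite !step; apply: le_trans
  (le_normcD (Num.sqrt (series (sqnorms a) n) +i* normc (a n))
             (Num.sqrt (series (sqnorms b) n) +i* normc (b n))).
rewrite ler_wsqrtr// lerD//.
  by rewrite ler_sqr ?nnegrE ?addr_ge0 ?sqrtr_ge0.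
have nge0 (z : R[i]) : 0 <= normc z by case: z => x y; exact: sqrtr_ge0.
by rewrite ler_sqr ?nnegrE ?addr_ge0//; exact: le_normcD.
Qed.

Lemma l2norm_ge0 a : 0 <= l2norm a.
Proof. exact: sqrtr_ge0. Qed.

Lemma l2normD a b :
  cvgn (series (sqnorms a)) -> cvgn (series (sqnorms b)) ->
  cvgn (series (sqnorms (a + b))) /\ l2norm (a + b) <= l2norm a + l2norm b.
Proof.
move=> ca cb; apply: l2norm_le; first by rewrite addr_ge0 ?l2norm_ge0.
move=> n; have le_sqrt c : cvgn (series (sqnorms c)) ->
    Num.sqrt (series (sqnorms c) n) <= l2norm c.
  move=> cc; rewrite -[leRHS]ger0_norm ?l2norm_ge0// -sqrtr_sqr.
  by rewrite ler_wsqrtr// le_series_l2norm.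
rewrite -[leLHS]sqr_sqrtr ?series_sqnorms_ge0//.
rewrite ler_sqr ?nnegrE ?addr_ge0 ?sqrtr_ge0 ?l2norm_ge0//.
by rewrite (le_trans (sqrt_series_sqnormsD _ _ _))// lerD ?le_sqrt.
Qed.

Lemma series_sqnormsZ (k : R[i]) a :
  series (sqnorms (k *: a)) = normc k ^+ 2 *: series (sqnorms a).
Proof.
apply/funext => n; rewrite !seriesEnat /= [RHS]mulr_sumr.
by apply: eq_bigr => i _; rewrite /sqnorms normcM exprMn.
Qed.

Lemma l2normZ (k : R[i]) a : cvgn (series (sqnorms a)) ->
  cvgn (series (sqnorms (k *: a))) /\ l2norm (k *: a) = normc k * l2norm a.
Proof.
move=> ca; rewrite /l2norm series_sqnormsZ; split; first exact: is_cvgZr.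
have nk : 0 <= normc k by case: (k) => x y; exact: sqrtr_ge0.
by rewrite limZr// sqrtrM ?sqr_ge0// sqrtr_sqr ger0_norm.
Qed.

Lemma l2norm_eq0 a : cvgn (series (sqnorms a)) -> l2norm a = 0 -> a = 0.
Proof.
move=> ca a0; apply/funext => n; apply: eq0_normc; apply/eqP.
have := le_series_l2norm n.+1 ca.
rewrite a0 expr0n /= seriesSr => h; rewrite -sqrf_eq0.
rewrite eq_le sqr_ge0 andbT; apply: le_trans h.
by rewrite lerDr series_sqnorms_ge0.
Qed.

Lemma square_summable_submod_closed : submod_closed square_summable.
Proof.
split=> [|k a b /square_summableP ca /square_summableP cb].
  apply/square_summableP; have [] // := @l2norm_le 0 0 => // n.
  rewrite seriesEnat /= big1 ?expr0n// => i _.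
  by rewrite /sqnorms normc0 expr0n.
by apply/square_summableP; have [] := l2normD (l2normZ k ca).1 cb.
Qed.

HB.instance Definition _ :=
  GRing.isSubmodClosed.Build _ _ square_summable square_summable_submod_closed.

End SquareSummable.

(* [f n] is the coefficient of [n.+1^-s] in the Dirichlet series [f]. *)
Record dirichletH2 (R : realType) := DirichletH2 {
  coefs :> nat -> R[i]^o;
  coefs_square_summable : coefs \in @square_summable R }.

Section DirichletH2.
Variable R : realType.
Local Notation H2 := (dirichletH2 R).
Implicit Types f g : H2.

HB.instance Definition _ := [isSub for @coefs R].
HB.instance Definition _ := [Choice of H2 by <:].
HB.instance Definition _ := [SubChoice_isSubLmodule of H2 by <:].

Definition H2norm f : R[i] := (l2norm f)%:C.

Let cvg_sqnorms f : cvgn (series (sqnorms f)).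
Proof. by apply/square_summableP; exact: coefs_square_summable. Qed.

Lemma H2normD f g : H2norm (f + g) <= H2norm f + H2norm g.
Proof.
by rewrite -rmorphD lecR; exact: (l2normD (@cvg_sqnorms f) (@cvg_sqnorms g)).2.
Qed.

Lemma H2normZ (k : R[i]) f : H2norm (k *: f) = `|k| * H2norm f.
Proof.
by rewrite /H2norm (l2normZ k (@cvg_sqnorms f)).2 rmorphM; case: k.
Qed.

Lemma H2norm_eq0 f : H2norm f = 0 -> f = 0.
Proof.
by move=> [f0]; apply: val_inj; exact: l2norm_eq0 (@cvg_sqnorms f) f0.
Qed.

HB.instance Definition _ :=
  Lmodule_isNormed.Build R[i] H2 H2normD H2normZ H2norm_eq0.

Definition H2dot f g : R[i]^o := limn (series (fun n => f n * (g n)^* : R[i]^o)).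

End DirichletH2.

Section CompositionOperators.
Variable R : realType.
Implicit Types s z : R[i].

Definition cexp z : R[i] :=
  (expR (complex.Re z))%:C * (cos (complex.Im z) +i* sin (complex.Im z)).

(* [n^s]; meaningful for [1 <= n] only, since [ln 0 = 0]. *)
Definition natcpow (n : nat) s : R[i] := cexp (s * (ln n%:R)%:C).

Definition dirichlet_eval (f : dirichletH2 R) s : R[i]^o :=
  limn (series (fun n => f n * natcpow n.+1 (- s) : R[i]^o)).

(* Elements of H^2 are identified with the functions they define on the
   half-plane Re s > 1/2, where their series converge. *)
Definition is_composition_operator (phi : R[i] -> R[i])
    (T : bounded_operator (dirichletH2 R)) :=
  forall f s, 1 / 2 < complex.Re s ->
    dirichlet_eval (T f) s = dirichlet_eval f (phi s).

End CompositionOperators.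

(* Main.v *)
From HB Require Import structures.
Require Import Defs.
From mathcomp Require Import all_boot all_order all_algebra.
From mathcomp Require Import complex.
From mathcomp Require Import all_classical all_reals all_analysis.
From mathcomp Require Import ring lra zify.

(** Write [b] for the integer [c0] and [e_n] for the function [n^-s], which is
the basis vector [deltaH2 R n.-1]. The composition operator [C] sends [e_n] to
[n^-c1] times [e_(n^b)]: it fixes [e_1], and on the orbit [m, m^b, m^(b^2), ...]
of any [m >= 2] it is a weighted shift with nonzero weights of modulus at most
1.

Let [T] commute with every operator that commutes with [C]. The projection on
[e_1] commutes with [C], so [T e_1 = l e_1] for a scalar [l]. For [m >= 2] the
weights along the orbit of [m] are no larger than those along the orbit of 2,
so there is a bounded diagonal operator [X] that commutes with [C] and sends
[e_2] to [e_m] ([intertwiner]); hence [T e_m = X (T e_2)]. It follows that one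
formal power series [sum a_k z^k], read off from [T e_2], describes [T] on the
whole complement of [e_1] ([bicommutant_power_series]).

The series is summed by Fejer means. Grade the integers [n >= 2] so that
[n^b] has grade one more than [n]; then [C^k] raises grades by [k], and the
[n]-th Fejer mean of the series is the average of the compressions [P_l T P_l]
to windows of [n] consecutive grades ([fejer_compression]). As each grade
belongs to [n] windows, its norm is at most that of [T] ([fejer_norm_le]), and
being bounded and coordinatewise convergent the means converge weakly to [T] off
[e_1]. At [e_1] the polynomial [p] of a Fejer mean has value [p(1)], not [l];
adding [(l - p(1)) C^N] corrects this, and the correction tends weakly to 0
on the complement as [N] grows ([polynomial_with_eigenvalue]). So [T] is in the
closure of the polynomials in [C]. The converse holds for any bounded operator,
because commuting with a given operator is a condition on matrix coefficients
([closure_WOT_bicommutant]).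

The operator [C] exists because [n |-> n^b] is injective and the weights are
bounded ([composition_operator_exists], [composition_eval]). An operator that
realizes the composition is equal to [C], since a Dirichlet series is
determined by its values at the positive integers ([dirichlet_uniqueness]). *)

Set Implicit Arguments.
Unset Strict Implicit.
Unset Printing Implicit Defensive.

Import Order.TTheory GRing.Theory Num.Theory.
Import numFieldNormedType.Exports Normc.
Local Open Scope classical_set_scope.
Local Open Scope complex_scope.
Local Open Scope ring_scope.

(** * Limits of complex sequences *)

Section ComplexLimits.

Variable R : realType.
Implicit Types (u v : nat -> R[i]^o) (z l : R[i]).

Lemma normc_ge0 z : 0 <= normc z.
Proof. by case: z => x y; exact: sqrtr_ge0. Qed.

Lemma normc_sum (I : Type) (s : seq I) (P : pred I) (F : I -> R[i]) :
  normc (\sum_(i <- s | P i) F i) <= \sum_(i <- s | P i) normc (F i).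
Proof.
elim/big_rec2: _ => [|i x y _ h]; first by rewrite normc0.
by rewrite (le_trans (le_normcD _ _))// lerD.
Qed.

Lemma normE z : `|z| = (normc z)%:C.
Proof. by []. Qed.

Lemma normcC (x : R) : normc x%:C = `|x|.
Proof. by rewrite /= expr0n addr0 sqrtr_sqr. Qed.

Lemma normc_conj z : normc z^* = normc z.
Proof. by case: z => x y /=; rewrite sqrrN. Qed.

Lemma le_normc_Re z : `|complex.Re z| <= normc z.
Proof.
by case: z => x y /=; rewrite -sqrtr_sqr ler_wsqrtr// lerDl sqr_ge0.
Qed.

Lemma le_normc_Im z : `|complex.Im z| <= normc z.
Proof.
by case: z => x y /=; rewrite -sqrtr_sqr ler_wsqrtr// lerDr sqr_ge0.
Qed.

Lemma normc_le_ReIm z : normc z <= `|complex.Re z| + `|complex.Im z|.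
Proof.
case: z => x y; have -> : x +i* y = x%:C + 'i * y%:C.
  by apply/eqP; rewrite eq_complex /=; apply/andP; split; apply/eqP; ring.
rewrite (le_trans (le_normcD _ _))// normcM !normcC /=.
by rewrite !(mul0r, mul1r, addr0, add0r, subr0) expr0n expr1n add0r sqrtr1 mul1r.
Qed.

Lemma norm_ltc (z : R[i]^o) (e : R) : (`|z| < e%:C) = (normc z < e).
Proof. exact: ltcR. Qed.

Lemma cvgcP u l : (u @ \oo --> (l : R[i]^o))%classic <->
  forall e : R, 0 < e -> \forall n \near \oo, normc (l - u n) < e.
Proof.
split=> [/cvgrPdist_lt h e e0|h].
  have e0' : 0 < e%:C :> R[i] by rewrite ltcR.
  by near do rewrite -norm_ltc; apply: h.
apply/cvgrPdist_lt => -[a b]; rewrite ltcE /= => /andP[/eqP-> a0].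
by near do rewrite -[_ +i* _]/(a%:C) norm_ltc; apply: h.
Unshelve. all: by end_near. Qed.

Lemma cvgc_unique u l l' : (u @ \oo --> (l : R[i]^o))%classic ->
  (u @ \oo --> (l' : R[i]^o))%classic -> l = l'.
Proof. exact: (@cvg_unique _ (@norm_hausdorff _ R[i]^o)). Qed.

Lemma limc_eq u l : (u @ \oo --> (l : R[i]^o))%classic -> limn u = l.
Proof. by move=> h; apply: (@cvg_lim _ (@norm_hausdorff _ R[i]^o)). Qed.

Lemma normc_cvg_le u l (M : R) : (u @ \oo --> (l : R[i]^o))%classic ->
  (\forall n \near \oo, normc (u n) <= M) -> normc l <= M.
Proof.
move=> /cvgcP h uM; apply/ler_addgt0Pr => e e0.
have [N _ /(_ N (leqnn N)) [/= hN uN]] : \forall n \near \oo,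
    normc (l - u n) < e /\ normc (u n) <= M.
  by near=> n; split; near: n; [exact: h|exact: uM].
have -> : l = (l - u N) + u N by rewrite subrK.
by rewrite (le_trans (le_normcD _ _))// addrC lerD// ltW.
Unshelve. all: by end_near. Qed.

Lemma cvgc_ReIm u : cvgn (fun n => complex.Re (u n) : R) ->
  cvgn (fun n => complex.Im (u n) : R) -> cvgn u.
Proof.
move=> /cvg_ex[a /cvgrPdist_lt ha] /cvg_ex[b /cvgrPdist_lt hb].
apply/cvg_ex; exists (a +i* b); apply/cvgcP => e e0.
have e2 : 0 < e / 2 by rewrite divr_gt0.
near=> n; rewrite (le_lt_trans (normc_le_ReIm _))// [e]splitr ltrD//.
  have -> : complex.Re (a +i* b - u n) = a - complex.Re (u n) by case: (u n).
  by near: n; apply: ha.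
have -> : complex.Im (a +i* b - u n) = b - complex.Im (u n) by case: (u n).
by near: n; apply: hb.
Unshelve. all: by end_near. Qed.

(** Passing through real and imaginary parts reduces completeness of the
complex numbers to that of the reals. *)
Lemma series_normc_cvg u :
  cvgn (series (fun n => normc (u n) : R)) -> cvgn (series u).
Proof.
move=> cu.
have aux (p : {additive R[i] -> R}) : (forall z, `|p z| <= normc z) ->
    cvgn ((fun n => p (series u n)) : nat -> R).
  move=> hp; have -> : (fun n => p (series u n)) = series (fun n => p (u n)).
    by apply/funext => n; rewrite !seriesEnat /= raddf_sum.
  apply: normed_cvg; apply: series_le_cvg cu => n //=.
  exact: normc_ge0.
apply: cvgc_ReIm.
  exact: (aux (@complex.Re R) le_normc_Re).
exact: (aux (@complex.Im R) le_normc_Im).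
Qed.

End ComplexLimits.

(** * The Hilbert space of square summable coefficients *)

Section HilbertSpace.

Variable R : realType.
Local Notation H2 := (dirichletH2 R).
Implicit Types (f g x y : H2).

Lemma H2P f : cvgn (series (sqnorms f)).
Proof. by apply/square_summableP; exact: coefs_square_summable. Qed.
#[local] Arguments H2P f : clear implicits.

Lemma coefsD f g n : (f + g) n = f n + g n. Proof. by []. Qed.
Lemma coefsB f g n : (f - g) n = f n - g n. Proof. by []. Qed.
Lemma coefsZ (c : R[i]) f n : (c *: f) n = c * f n. Proof. by []. Qed.

Lemma coefs_sum (I : Type) (s : seq I) (P : pred I) (F : I -> H2) n :
  (\sum_(i <- s | P i) F i) n = \sum_(i <- s | P i) F i n.
Proof. by elim/big_rec2: _ => // i a b _ <-. Qed.

Lemma H2_ext f g : (forall n, f n = g n) -> f = g.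
Proof. by move=> h; apply: val_inj; apply/funext. Qed.

Lemma H2_exists (a : nat -> R[i]^o) (M : R) : 0 <= M ->
  (forall n, series (sqnorms a) n <= M ^+ 2) ->
  exists2 f : H2, (forall n, f n = a n) & l2norm f <= M.
Proof.
move=> M0 h; have [/square_summableP ca na] := l2norm_le M0 h.
by exists (DirichletH2 ca).
Qed.

Lemma le_partial f n : series (sqnorms f) n <= l2norm f ^+ 2.
Proof. exact: le_series_l2norm (H2P f). Qed.

Lemma le_H2norm f (M : R) : 0 <= M ->
  (forall n, series (sqnorms f) n <= M ^+ 2) -> l2norm f <= M.
Proof. by move=> M0 h; case: (l2norm_le M0 h). Qed.

Lemma le_coef f n : normc (f n) <= l2norm f.
Proof.
rewrite -(@ler_pXn2r _ 2)// ?nnegrE ?l2norm_ge0 ?normc_ge0//.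
rewrite (le_trans _ (le_partial f n.+1))// seriesSr lerDr.
exact: series_sqnorms_ge0.
Qed.

Lemma H2norm_triangle f g : l2norm (f + g) <= l2norm f + l2norm g.
Proof. by have [] := l2normD (H2P f) (H2P g). Qed.

Lemma H2norm_scale (c : R[i]) f : l2norm (c *: f) = normc c * l2norm f.
Proof. by have [] := l2normZ c (H2P f). Qed.

Lemma H2_normE f : `|f| = (l2norm f)%:C.
Proof. by []. Qed.

Lemma bop_bound (T : bounded_operator H2) :
  exists2 M : R, 0 <= M & forall x, l2norm (T x) <= M * l2norm x.
Proof.
have /linear_boundedP[M [Mr h]] := bop_bounded T.
exists (normc M + 1) => [|x]; first by rewrite addr_ge0 ?normc_ge0.
have /h/(_ x) : M < (normc M + 1)%:C.
  by rewrite rmorphD /= -normE (le_lt_trans (real_ler_norm Mr))// ltrDl.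
by rewrite !H2_normE -rmorphM lecR.
Qed.

Lemma bop_exists (F : H2 -> H2) (M : R) : linear F -> 0 <= M ->
  (forall x, l2norm (F x) <= M * l2norm x) ->
  exists T : bounded_operator H2, forall x, T x = F x.
Proof.
move=> lF M0 hM.
pose L : {linear H2 -> H2} := HB.pack F (GRing.isLinear.Build _ _ _ _ F lF).
have bL : bounded_near L (nbhs (0 : H2)).
  apply/linear_boundedP.
  exists (M%:C); split; first by rewrite ger0_real// lecR.
  move=> r hr x.
  rewrite !H2_normE.
  apply: le_trans (_ : M%:C * (l2norm x)%:C <= _).
    by rewrite -rmorphM lecR; exact: hM.
  by rewrite ler_wpM2r ?lecR ?l2norm_ge0// ltW.
by exists (BoundedOperator bL).
Qed.

Lemma bopZ (T : bounded_operator H2) (c : R[i]) x : T (c *: x) = c *: T x.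
Proof. exact: linearZZ. Qed.
Lemma bopD (T : bounded_operator H2) x y : T (x + y) = T x + T y.
Proof. exact: linearD. Qed.
Lemma bopB (T : bounded_operator H2) x y : T (x - y) = T x - T y.
Proof. exact: linearB. Qed.
Lemma bop_sum (T : bounded_operator H2) (I : Type) (s : seq I) (P : pred I) (F : I -> H2) :
  T (\sum_(i <- s | P i) F i) = \sum_(i <- s | P i) T (F i).
Proof. exact: linear_sum. Qed.

Lemma sum_reindex_le (F : nat -> R) (P : pred nat) (sg : nat -> nat) N :
  (forall i, 0 <= F i) ->
  (forall i j, P i -> P j -> sg i = sg j -> i = j) ->
  exists L, \sum_(0 <= j < N | P j) F (sg j) <= \sum_(0 <= i < L) F i.
Proof.
move=> F0 inj; pose s := map sg (seq.filter P (index_iota 0 N)).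
exists (\max_(i <- s) i).+1.
rewrite -[leLHS]big_filter.
have -> : \sum_(j <- [seq j <- index_iota 0 N | P j]) F (sg j) = \sum_(i <- s) F i.
  by rewrite big_map.
have us : uniq s.
  rewrite map_inj_in_uniq ?filter_uniq ?iota_uniq// => i j.
  by rewrite !mem_filter => /andP[Pi _] /andP[Pj _]; exact: inj.
set L := (\max_(i <- s) i).+1.
have /(perm_big _) -> : perm_eq s (seq.filter (mem s) (index_iota 0 L)).
  apply: uniq_perm => //; first by rewrite filter_uniq ?iota_uniq.
  move=> i; rewrite mem_filter /= mem_index_iota /=.
  by case: (boolP (i \in s)) => //= si; rewrite ltnS; exact/esym/leq_bigmax_seq.
rewrite big_filter big_mkcond /=; apply: ler_sum => i _.
by case: ifP.
Qed.

(** The common source of all concrete operators below (masks, the composition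
operator, intertwiners): the entries of [f] are permuted without repetition, so
the norm does not increase. *)
Lemma weighted_substitution_exists (w : nat -> R[i]) (sg : nat -> nat) :
  (forall j, normc (w j) <= 1) ->
  (forall i j, w i != 0 -> w j != 0 -> sg i = sg j -> i = j) ->
  exists2 T : bounded_operator H2,
    (forall f j, T f j = w j * f (sg j)) &
    (forall f, l2norm (T f) <= l2norm f).
Proof.
move=> w1 inj.
have hb f : exists2 g : H2, (forall j, g j = w j * f (sg j)) & l2norm g <= l2norm f.
  apply: (@H2_exists (fun j => w j * f (sg j))); first exact: l2norm_ge0.
  move=> n; have [] := @sum_reindex_le (sqnorms f) (fun j => w j != 0) sg n.
  - by move=> i; exact: sqr_ge0.
  - exact: inj.
  move=> L hL; apply: le_trans (le_partial f L).
  rewrite !seriesEnat/=; apply: le_trans hL; rewrite [leRHS]big_mkcond/=.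
  apply: ler_sum => j _; rewrite /sqnorms normcM exprMn.
  case: (eqVneq (w j) 0) => [->|_]; first by rewrite normc0 expr0n mul0r.
  by rewrite /= ler_piMl ?sqr_ge0// exprn_ile1 ?normc_ge0.
have [F hF] := choice (fun f => (let: ex_intro2 g a b := hb f in
   ex_intro (fun g : H2 => (forall j, g j = w j * f (sg j)) /\ l2norm g <= l2norm f) g (conj a b))).
have lF : linear F.
  move=> a u v; apply: H2_ext => j.
  rewrite coefsD coefsZ !(hF _).1 coefsD coefsZ; ring.
have [|T hT] := bop_exists lF (@ler01 R).
  by move=> x; rewrite mul1r; exact: (hF x).2.
by exists T => [f j|f]; rewrite hT; [exact: (hF f).1|exact: (hF f).2].
Qed.

Lemma sum_cauchy_schwarz (a b : nat -> R) m n :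
  (forall i, 0 <= a i) -> (forall i, 0 <= b i) ->
  (\sum_(m <= i < n) a i * b i) ^+ 2 <=
  (\sum_(m <= i < n) a i ^+ 2) * (\sum_(m <= i < n) b i ^+ 2).
Proof.
move=> a0 b0; elim: n => [|n IH]; first by rewrite !big_geq// expr0n mul0r.
case: (leqP m n) => mn; last by rewrite !big_geq// expr0n mul0r.
rewrite !big_nat_recr//=.
move: IH; set s := \sum_(_ <= _ < _) _ * _; set A := \sum_(_ <= _ < _) a _ ^+ _.
set B := \sum_(_ <= _ < _) _ => IH.
have A0 : 0 <= A by apply: sumr_ge0 => i _; exact: sqr_ge0.
have B0 : 0 <= B by apply: sumr_ge0 => i _; exact: sqr_ge0.
have s0 : 0 <= s by apply: sumr_ge0 => i _; rewrite mulr_ge0.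
have an := a0 n; have bn := b0 n.
have cross : 2 * s * (a n * b n) <= a n ^+ 2 * B + b n ^+ 2 * A.
  rewrite -(@ler_pXn2r _ 2)// ?nnegrE; last 2 first.
  - by rewrite !mulr_ge0.
  - by rewrite addr_ge0// mulr_ge0// sqr_ge0.
  apply: (@le_trans _ _ (4 * (A * B) * (a n * b n) ^+ 2)).
    rewrite [leLHS](_ : _ = 4 * s ^+ 2 * (a n * b n) ^+ 2); last by ring.
    by rewrite ler_wpM2r ?sqr_ge0// ler_wpM2l.
  rewrite -subr_ge0 [leRHS](_ : _ = (a n ^+ 2 * B - b n ^+ 2 * A) ^+ 2) ?sqr_ge0//.
  by ring.
nra.
Qed.

Lemma tail_small f (e : R) : 0 < e ->
  exists K, forall n, \sum_(K <= i < n) normc (f i) ^+ 2 <= e.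
Proof.
move=> e0; have /cvgrPdist_lt/(_ e e0)[K _ /(_ K (leqnn K)) /= hK] := H2P f.
exists K => n; case: (leqP K n) => Kn; last by rewrite big_geq ?(ltnW Kn)// ltW.
rewrite (_ : \sum_(_ <= _ < _) _ = series (sqnorms f) n - series (sqnorms f) K).
  have := nondecreasing_cvgn_le (@nondecreasing_sqnorms _ f) (H2P f) n.
  by have := ltr_normlW hK; lra.
by rewrite !seriesEnat /=; apply/eqP; rewrite eq_sym subr_eq addrC -big_cat_nat.
Qed.

End HilbertSpace.
Arguments H2P {R} f.

(** * Weak convergence of bounded sequences *)

Section WeakConvergence.

Variable R : realType.
Local Notation H2 := (dirichletH2 R).
Implicit Types (f g x y : H2).

Lemma le_partial_dot f g m n :
  \sum_(m <= i < n) normc (f i * (g i)^*) <=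
  l2norm f * Num.sqrt (\sum_(m <= i < n) normc (g i) ^+ 2).
Proof.
set B := \sum_(_ <= _ < _) _ ^+ 2.
have B0 : 0 <= B by apply: sumr_ge0 => i _; exact: sqr_ge0.
rewrite -(@ler_pXn2r _ 2)// ?nnegrE; last 2 first.
- by apply: sumr_ge0 => i _; exact: normc_ge0.
- by rewrite mulr_ge0 ?l2norm_ge0 ?sqrtr_ge0.
under eq_bigr do rewrite normcM normc_conj.
apply: le_trans (sum_cauchy_schwarz _ _ _ _) _; try by move=> i; exact: normc_ge0.
rewrite exprMn [Num.sqrt B ^+ 2]sqr_sqrtr// ler_wpM2r//.
apply: le_trans (le_partial f n); rewrite seriesEnat /=.
case: (leqP m n) => mn; last first.
  by rewrite big_geq ?(ltnW mn)// sumr_ge0// => i _; exact: sqr_ge0.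
rewrite (big_cat_nat (leq0n m) mn)/= lerDr.
by apply: sumr_ge0 => i _; exact: sqr_ge0.
Qed.

Lemma le_sqrt_partial f n :
  Num.sqrt (\sum_(0 <= i < n) normc (f i) ^+ 2) <= l2norm f.
Proof.
rewrite -[leRHS]ger0_norm ?l2norm_ge0// -sqrtr_sqr ler_wsqrtr//.
by have := le_partial f n; rewrite seriesEnat.
Qed.

Lemma H2dot_cvg f g :
  (series (fun n => f n * (g n)^* : R[i]^o) @ \oo --> H2dot f g)%classic.
Proof.
suff : cvgn (series (fun n => f n * (g n)^* : R[i]^o)) by [].
apply: series_normc_cvg; apply: nondecreasing_is_cvgn.
  by apply: nondecreasing_series => i _ _; exact: normc_ge0.
exists (l2norm f * l2norm g) => _ [n _ <-]; rewrite seriesEnat /=.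
apply: le_trans (le_partial_dot f g 0 n) _.
by rewrite ler_wpM2l ?l2norm_ge0// le_sqrt_partial.
Qed.

Lemma H2dotBl f g h : H2dot (f - g) h = H2dot f h - H2dot g h.
Proof.
apply: limc_eq; set u := series _.
have -> : u = series (fun n => f n * (h n)^* : R[i]^o)
            - series (fun n => g n * (h n)^* : R[i]^o).
  apply/funext => n; rewrite /u !fctE !seriesEnat /= -sumrB.
  by apply: eq_bigr => i _; rewrite -mulrBl.
by apply: cvgB; exact: H2dot_cvg.
Qed.

(** A bounded sequence in l^2 that converges coordinatewise converges weakly:
the tail of [y] controls all but finitely many coordinates uniformly. *)
Lemma weak_cvg (z : nat -> H2) x (M : R) :
  (forall n, l2norm (z n) <= M) ->
  (forall j, (z n j @[n --> \oo] --> (x j : R[i]^o))%classic) ->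
  forall y, (H2dot (z n) y @[n --> \oo] --> H2dot x y)%classic.
Proof.
move=> zM zx y; apply/cvgcP => e e0.
(* the summand 1 only makes this bound on all [l2norm (x - z n)] positive *)
pose M' := l2norm x + M + 1.
have M'0 : 0 < M'.
  by rewrite /M' ltr_wpDl// addr_ge0 ?l2norm_ge0// (le_trans (l2norm_ge0 (z 0%N)))//.
have d0 : 0 < e / 2 / M' by rewrite !divr_gt0.
have [K hK] := tail_small y (exprn_gt0 2 d0).
have head : ((\sum_(0 <= i < K) (x i - z n i) * (y i)^*) @[n --> \oo] --> (0 : R[i]^o))%classic.
  elim: (K) => [|k IH].
    by under eq_cvg do rewrite big_geq//; exact: cvg_cst.
  under eq_cvg do rewrite big_nat_recr//=.
  have xz : ((x k - z n k : R[i]^o) @[n --> \oo] --> (0 : R[i]^o))%classic.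
    have := cvgB (cvg_cst (x k : R[i]^o)) (zx k).
    by rewrite subrr => h; exact: h.
  have xzy : (((x k - z n k) * (y k)^* : R[i]^o) @[n --> \oo] --> (0 : R[i]^o))%classic.
    have := cvgM xz (cvg_cst ((y k)^* : R[i]^o)).
    by rewrite mul0r => h; exact: h.
  have := cvgD IH xzy.
  by rewrite addr0 => h; exact: h.
have e2 : 0 < e / 2 / 2 by rewrite !divr_gt0.
move/cvgcP/(_ _ e2) : head => head.
near=> n; rewrite -H2dotBl.
have hn : normc (\sum_(0 <= i < K) (x i - z n i) * (y i)^*) < e / 2 / 2.
  by rewrite -normcN -sub0r; near: n.
apply: (@le_lt_trans _ _ (e / 2 / 2 + e / 2)); last by lra.
apply: normc_cvg_le (@H2dot_cvg (x - z n) y) _.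
exists K => // N /= KN; rewrite seriesEnat /= (big_cat_nat (leq0n K) KN) /=.
apply: le_trans (le_normcD _ _) _; apply: lerD; first exact: ltW.
apply: le_trans (normc_sum _ _ _) _; apply: le_trans (le_partial_dot (x - z n) y K N) _.
apply: (@le_trans _ _ (M' * (e / 2 / M'))); last first.
  by rewrite mulrC divfK ?gt_eqF.
apply: ler_pM; rewrite ?l2norm_ge0 ?sqrtr_ge0//.
  rewrite /M' (le_trans (H2norm_triangle _ _))//.
  rewrite -scaleN1r H2norm_scale normcN normc1 mul1r.
  by rewrite -addrA lerD2l (le_trans (zM n))// lerDl.
by rewrite -[leRHS]ger0_norm ?(ltW d0)// -sqrtr_sqr ler_wsqrtr.
Unshelve. all: by end_near. Qed.

End WeakConvergence.

(** * Basis vectors, coordinate functionals and the weak operator topology *)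

Section Riesz.

Variable R : realType.
Local Notation H2 := (dirichletH2 R).
Implicit Types (f g x y : H2) (T : bounded_operator H2).

Lemma deltaH2_summable k :
  (fun n => (n == k)%:R : R[i]^o) \in @square_summable R.
Proof.
apply/square_summableP; have [] // := @l2norm_le R (fun n => (n == k)%:R) 1 => //.
move=> n; rewrite seriesEnat /= expr1n.
rewrite (eq_bigr (fun i => if i == k then 1 else 0)); last first.
  move=> i _; rewrite /sqnorms; case: eqP => _; first by rewrite normc1 expr1n.
  by rewrite normc0 expr0n.
by rewrite -big_mkcond big_nat1_eq; case: ifP.
Qed.

Definition deltaH2 k : H2 := DirichletH2 (deltaH2_summable k).

Lemma coefs_finite_sum (u : nat -> R[i]) N j :
  (\sum_(0 <= n < N) u n *: deltaH2 n) j = if (j < N)%N then u j else 0.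
Proof.
rewrite coefs_sum (eq_bigr (fun i => if i == j then u i else 0)); last first.
  move=> i _; rewrite coefsZ /= eq_sym.
  by case: eqP => _; rewrite ?mulr1 ?mulr0.
by rewrite -big_mkcond big_nat1_eq.
Qed.

Lemma H2dot_delta x k : H2dot x (deltaH2 k) = x k.
Proof.
apply: limc_eq; apply/cvgcP => e e0; near=> n.
suff -> : series (fun i => x i * (deltaH2 k i)^* : R[i]^o) n = x k.
  by rewrite subrr normc0.
rewrite seriesEnat /= (eq_bigr (fun i => if i == k then x i else 0)); last first.
  move=> i _.
  by rewrite conjC_nat; case: (i == k); rewrite ?mulr1 ?mulr0.
rewrite -big_mkcond big_nat1_eq /= ifT//.
by near: n; exists k.+1.
Unshelve. all: by end_near. Qed.

(** Finite truncations are norm dense, so a coordinate of [T x] is the sum of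
the series obtained by expanding [x]. *)
Lemma coord_series T x k :
  (series (fun n => x n * T (deltaH2 n) k : R[i]^o) @ \oo --> (T x k : R[i]^o))%classic.
Proof.
have [M M0 hM] := bop_bound T.
apply/cvgcP => e e0.
have d0 : 0 < e / 2 / (M + 1) by rewrite !divr_gt0// ltr_wpDl.
have [K hK] := tail_small x (exprn_gt0 2 d0).
exists K => // N /= KN.
pose t := \sum_(0 <= n < N) x n *: deltaH2 n.
have tE j : t j = if (j < N)%N then x j else 0 by exact: coefs_finite_sum.
have -> : series (fun n => x n * T (deltaH2 n) k : R[i]^o) N = T t k.
  rewrite seriesEnat /= /t bop_sum coefs_sum.
  by apply: eq_bigr => i _; rewrite bopZ coefsZ.
have -> : T x k - T t k = T (x - t) k by rewrite bopB coefsB.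
apply: (le_lt_trans (le_coef _ _)); apply: (le_lt_trans (hM _)).
have xtE i : sqnorms (x - t) i = normc (x i - t i) ^+ 2 by [].
have tl : l2norm (x - t) <= e / 2 / (M + 1).
  apply: le_H2norm; first exact: ltW.
  move=> n; rewrite seriesEnat /=.
  apply: le_trans (hK n).
  case: (leqP K n) => Kn; last first.
    rewrite big_nat_cond big1; last first.
      move=> i /andP[/andP[_ iN] _]; rewrite xtE tE.
      by rewrite (ltn_trans iN (leq_trans Kn KN)) subrr normc0 expr0n.
    by apply: sumr_ge0 => i _; exact: sqr_ge0.
  rewrite (big_cat_nat (leq0n K) Kn)/= big_nat_cond big1 ?add0r.
    apply: ler_sum => i _; rewrite xtE tE.
    by case: ifP => _; rewrite ?subr0// subrr normc0 expr0n sqr_ge0.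
  move=> i /andP[/andP[_ iK] _]; rewrite xtE tE.
  by rewrite (leq_trans iK KN) subrr normc0 expr0n.
apply: (@le_lt_trans _ _ (M * (e / 2 / (M + 1)))); first by rewrite ler_wpM2l.
apply: (@le_lt_trans _ _ ((M + 1) * (e / 2 / (M + 1)))).
  by rewrite ler_wpM2r ?(ltW d0)// lerDl.
by rewrite mulrC divfK; [lra|rewrite gt_eqF// ltr_wpDl].
Qed.

Lemma coord_ext T T' k :
  (forall n, T (deltaH2 n) k = T' (deltaH2 n) k) -> forall x, T x k = T' x k.
Proof.
move=> h x.
have E : (fun n => x n * T (deltaH2 n) k : R[i]^o) =
    (fun n => x n * T' (deltaH2 n) k : R[i]^o) by apply/funext => n; rewrite h.
have := @coord_series T x k; rewrite E => Tx.
exact: (cvgc_unique Tx (@coord_series T' x k)).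
Qed.

(** The coordinate functionals of a bounded operator are represented by
vectors (Riesz); square summability is tested on truncations of the
representing sequence itself. *)
Lemma coord_riesz T k : exists r : H2, forall x, H2dot x r = T x k.
Proof.
have [M M0 hM] := bop_bound T.
pose r n : R[i]^o := (T (deltaH2 n) k)^*.
have [|f fr _] := @H2_exists R r M M0; last first.
  exists f => x; apply: limc_eq.
  have -> : (fun n => x n * (f n)^* : R[i]^o) =
      (fun n => x n * T (deltaH2 n) k : R[i]^o).
    by apply/funext => n; rewrite fr /r conjCK.
  exact: coord_series.
move=> N; set A := series _ _.
have A0 : 0 <= A by exact: series_sqnorms_ge0.
pose z := \sum_(0 <= n < N) r n *: deltaH2 n.
have zE j : z j = if (j < N)%N then r j else 0 by exact: coefs_finite_sum.
have TzE : T z k = A%:C.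
  rewrite /A seriesEnat /= /z bop_sum coefs_sum rmorph_sum /=.
  apply: eq_bigr => i _; rewrite bopZ coefsZ /sqnorms normc_conj rmorphXn /=.
  by rewrite -normE normCK mulrC.
have zn : l2norm z <= Num.sqrt A.
  apply: le_H2norm; rewrite ?sqrtr_ge0// => n; rewrite sqr_sqrtr//.
  rewrite /A !seriesEnat /=.
  case: (leqP n N) => nN.
    rewrite [leRHS](big_cat_nat (leq0n n) nN)/= -[leLHS]addr0 lerD//; last first.
      by apply: sumr_ge0 => i _; exact: sqr_ge0.
    rewrite big_nat_cond [leRHS]big_nat_cond.
    apply: ler_sum => i /andP[/andP[_ ik] _]; rewrite /sqnorms zE.
    by rewrite (leq_trans ik nN).
  rewrite (big_cat_nat (leq0n N) (ltnW nN))/= [X in _ + X]big_nat_cond.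
  rewrite [X in _ + X]big1 ?addr0; last first.
    move=> i /andP[/andP[Ni _] _]; rewrite /sqnorms zE ifF; last by rewrite ltnNge Ni.
    by rewrite normc0 expr0n.
  rewrite big_nat_cond [leRHS]big_nat_cond.
  by apply: ler_sum => i /andP[/andP[_ ik] _]; rewrite /sqnorms zE ik.
have : A <= M * Num.sqrt A.
  rewrite -{1}[A]ger0_norm// -normcC -TzE.
  apply: le_trans (le_coef _ _) _; apply: le_trans (hM _) _.
  by rewrite ler_wpM2l.
case: (eqVneq A 0) => [->|An0]; first by rewrite sqr_ge0.
rewrite -{1}(sqr_sqrtr A0) expr2 ler_pM2r; last by rewrite sqrtr_gt0 lt_def An0.
by move=> h; rewrite -(sqr_sqrtr A0) ler_pXn2r// nnegrE sqrtr_ge0.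
Qed.

Local Notation WOT := (weak_operator_topology (@H2dot R)).

Lemma dot_WOT_continuous x y :
  continuous (fun T : WOT => H2dot (T x) y : R[i]^o).
Proof.
move=> T.
have c1 := @initial_continuous _ _ (matrix_coefs (@H2dot R)) T.
by have := continuous_comp c1 (@proj_continuous _ (fun=> R[i]^o) (x, y) _); exact.
Qed.

(** Sequences suffice for the approximations below; applied to points of the
closure itself, this allows limits to be taken twice. *)
Lemma closure_WOT_seq (A : set (bounded_operator H2))
    (Tn : nat -> bounded_operator H2) T :
  (forall n, (closure (A : set WOT)) (Tn n)) ->
  (forall x y, (H2dot (Tn n x) y @[n --> \oo] --> H2dot (T x) y)%classic) ->
  closure (A : set WOT) T.
Proof.
move=> ATn Tncvg.
apply: (@closed_cvg _ _ \oo%classic _ (Tn : nat -> WOT) _ (@closed_closure _ (A : set WOT))).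
  by apply: nearW.
have hp : (matrix_coefs (@H2dot R) (Tn n) @[n --> \oo] -->
    (matrix_coefs (@H2dot R) T : {ptws H2 * H2 -> R[i]^o}))%classic.
  by apply/pointwise_cvgP => -[x y]; exact: Tncvg.
move=> U; rewrite nbhsE => -[B [[C oC <-] BT] BU].
have := hp C; rewrite nbhsE /= => /(_ _)[|N _ hN]; first by exists C.
by exists N => // n Nn; apply: BU; exact: hN.
Qed.

(** A coordinate of [P (S x)] is a matrix coefficient of [P], and by
[coord_riesz] so is the same coordinate of [S (P x)]; commuting with [S] is
therefore a closed condition on [P]. *)
Lemma closure_WOT_bicommutant T :
  closure (poly_alg T : set WOT) `<=` commutant (commutant [set T]).
Proof.
move=> P clP S ST x; apply: H2_ext => k.
have [r hr] := coord_riesz S k.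
pose F (Q : WOT) : R[i]^o := H2dot (Q (S x)) (deltaH2 k) - H2dot (Q x) r.
have Fc : continuous F.
  move=> Q.
  exact: (@cvgB _ R[i]^o _ (nbhs Q) _ _ _ _ _ (@dot_WOT_continuous (S x) (deltaH2 k) Q)
    (@dot_WOT_continuous x r Q)).
have clF : closed (F @^-1` [set 0]).
  apply: (continuous_closedP F).1 => //.
  exact: accessible_closed_set1 (hausdorff_accessible (@norm_hausdorff _ R[i]^o)) _.
have : closure (F @^-1` [set 0]) P.
  apply: closure_subset clP => Q [p Qp] /=.
  rewrite /F H2dot_delta hr; apply/eqP; rewrite subr_eq0; apply/eqP.
  congr (coefs _ _); rewrite !Qp bop_sum; apply: eq_bigr => i _.
  rewrite bopZ; congr (_ *: _).
  have comm z : S (T z) = T (S z) by apply: ST.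
  by elim: (nat_of_ord i) => [|n IH] //=; rewrite comm IH.
rewrite -(closure_id _).1// /F /= H2dot_delta hr.
by move/eqP; rewrite subr_eq0 => /eqP.
Qed.

End Riesz.

(** * Inverting a strictly increasing sequence of indices *)

Section FloorInverse.

Variable theta : nat -> nat.
Hypothesis theta_lt : forall i, (theta i < theta i.+1)%N.

(** The number of [i] with [theta i < N]; at [N = theta i] this is [i], so it
inverts [theta] on its range. *)
Fixpoint floor_inv (N : nat) : nat :=
  if N is N'.+1 then
    let r := floor_inv N' in if theta r == N' then r.+1 else r
  else 0%N.

Lemma theta_homo i j : (i < j)%N -> (theta i < theta j)%N.
Proof.
elim: j => // j IH; rewrite ltnS leq_eqVlt => /orP[/eqP->|/IH h].
  exact: theta_lt.
exact: ltn_trans h (theta_lt j).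
Qed.

Lemma theta_mono i j : (theta i < theta j)%N = (i < j)%N.
Proof.
case: (ltngtP i j) => [/theta_homo//|/theta_homo h|->]; last by rewrite ltnn.
by apply/negbTE; rewrite -leqNgt ltnW.
Qed.

Lemma theta_inj i j : theta i = theta j -> i = j.
Proof.
by move=> e; case: (ltngtP i j) => // /theta_homo; rewrite e ltnn.
Qed.

Lemma floor_invP N i : (i < floor_inv N)%N = (theta i < N)%N.
Proof.
elim: N i => [|N IH] i //=.
have IHr := IH (floor_inv N); have IHi := IH i.
rewrite ltnn in IHr.
case: eqP => [e|ne].
  rewrite ltnS leq_eqVlt [RHS]ltnS [RHS]leq_eqVlt IHi; congr (_ || _).
  by apply/eqP/eqP => [->//|h]; apply: theta_inj; rewrite h e.
rewrite [RHS]ltnS [RHS]leq_eqVlt IHi; case: eqP => //= e.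
rewrite e ltnn in IHi *; exfalso.
case: (ltngtP i (floor_inv N)) => [h|/theta_homo h|h].
- by rewrite h in IHi.
- by rewrite e in h; rewrite h in IHr.
- by apply: ne; rewrite -h e.
Qed.

Lemma floor_invK i : floor_inv (theta i) = i.
Proof.
case: (ltngtP (floor_inv (theta i)) i) => // h.
  by have := floor_invP (theta i) (floor_inv (theta i)); rewrite ltnn theta_mono h.
by have := floor_invP (theta i) i; rewrite h ltnn.
Qed.

End FloorInverse.

(** * Building bounded operators *)

Section OperatorAlgebra.

Variable R : realType.
Local Notation H2 := (dirichletH2 R).
Implicit Types (f g x y : H2) (T S C : bounded_operator H2).

Lemma bop_add T S : exists U : bounded_operator H2, forall x, U x = T x + S x.
Proof.
have [M M0 hM] := bop_bound T; have [N N0 hN] := bop_bound S.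
apply: (@bop_exists R (fun x => T x + S x) (M + N)); rewrite ?addr_ge0//.
  by move=> a u v; rewrite !bopD !bopZ scalerDr addrACA.
move=> x; rewrite mulrDl; apply: le_trans (H2norm_triangle _ _) _.
exact: lerD.
Qed.

Lemma bop_scale (c : R[i]) T :
  exists U : bounded_operator H2, forall x, U x = c *: T x.
Proof.
have [M M0 hM] := bop_bound T.
apply: (@bop_exists R (fun x => c *: T x) (normc c * M)).
- by move=> a u v; rewrite bopD bopZ scalerDr !scalerA mulrC.
- by rewrite mulr_ge0 ?normc_ge0.
- by move=> x; rewrite H2norm_scale -mulrA ler_wpM2l ?normc_ge0.
Qed.

Lemma bop_comp T S : exists U : bounded_operator H2, forall x, U x = T (S x).
Proof.
have [M M0 hM] := bop_bound T; have [N N0 hN] := bop_bound S.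
apply: (@bop_exists R (fun x => T (S x)) (M * N)); rewrite ?mulr_ge0//.
  by move=> a u v; rewrite !bopD !bopZ.
by move=> x; rewrite -mulrA (le_trans (hM _))// ler_wpM2l.
Qed.

Lemma bop_zero : exists U : bounded_operator H2, forall x, U x = 0.
Proof.
apply: (@bop_exists R (fun=> 0) 0) => // [a u v|x].
  by rewrite scaler0 addr0.
rewrite mul0r; apply: le_H2norm => // n; rewrite seriesEnat /= big1 ?expr0n//.
by move=> i _; rewrite /sqnorms normc0 expr0n.
Qed.

Lemma bop_mask (A : pred nat) : exists2 U : bounded_operator H2,
  (forall x j, U x j = if A j then x j else 0) & (forall x, l2norm (U x) <= l2norm x).
Proof.
have [j|i j _ _|U hU nU] :=
    @weighted_substitution_exists R (fun j => if A j then 1 else 0) id.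
- by case: ifP; rewrite ?normc1 ?normc0 ?ler01.
- by [].
- exists U => // x j; rewrite hU; case: ifP; rewrite ?mul1r ?mul0r//.
Qed.

Lemma bop_iter T k : exists U : bounded_operator H2, forall x, U x = iter k T x.
Proof.
elim: k => [|k [U hU]].
  have [U hU _] := bop_mask xpredT; exists U => x.
  by apply: H2_ext => j; rewrite hU.
by have [V hV] := bop_comp T U; exists V => x; rewrite hV hU.
Qed.

Lemma bop_iter_sum T (a : nat -> R[i]) n : exists U : bounded_operator H2,
  forall x, U x = \sum_(i < n) a i *: iter i T x.
Proof.
elim: n => [|n [U hU]].
  by have [U hU] := bop_zero; exists U => x; rewrite hU big_ord0.
have [V hV] := bop_iter T n; have [W hW] := bop_scale (a n) V.
have [Z hZ] := bop_add U W.
by exists Z => x; rewrite hZ hU hW hV big_ord_recr.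
Qed.

Lemma poly_algP T S (p : {poly R[i]}) n : (size p <= n)%N ->
  (forall x, S x = \sum_(i < n) p`_i *: iter i T x) -> poly_alg T S.
Proof.
move=> pn h; exists p => x; rewrite h.
rewrite (big_ord_widen n (fun i => p`_i *: iter i T x) pn).
rewrite [RHS]big_mkcond/=; apply: eq_bigr => i _.
by case: ifP => // /negbT; rewrite -leqNgt => /leq_sizeP/(_ i (leqnn _)) ->;
  rewrite scale0r.
Qed.

Lemma iter_comm S T x k : (forall x, S (T x) = T (S x)) ->
  S (iter k T x) = iter k T (S x).
Proof. by move=> h; elim: k => //= k IH; rewrite h IH. Qed.

End OperatorAlgebra.

(** * The orbits of taking b-th powers *)

Section Indices.

Variable b : nat.
Hypothesis b2 : (1 < b)%N.

(** The integer [n] has index [n.-1], so this is [n |-> n ^ b] on indices. *)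
Definition powi (i : nat) : nat := (i.+1 ^ b).-1.

Lemma powiS i : (powi i).+1 = (i.+1 ^ b)%N.
Proof. by rewrite /powi prednK// expn_gt0. Qed.

Lemma powi0 : powi 0 = 0%N.
Proof. by rewrite /powi exp1n. Qed.

Lemma powi_lt i : (powi i < powi i.+1)%N.
Proof. by rewrite -ltnS !powiS ltn_exp2r// ltnW. Qed.

Lemma powi_inj i j : powi i = powi j -> i = j.
Proof. exact: theta_inj powi_lt _ _. Qed.

Lemma powi_gt i : (0 < i)%N -> (i < powi i)%N.
Proof.
move=> i0; rewrite -ltnS powiS -{1}[i.+1]expn1 ltn_exp2l//.
Qed.

Lemma powi_neq1 i : powi i <> 1%N.
Proof.
case: i => [|i]; first by rewrite powi0.
by have := powi_gt (ltn0Sn i) => /[swap] ->; rewrite ltnS.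
Qed.

Definition orbi (m k : nat) : nat := iter k powi m.

Lemma orbiS m k : orbi m k.+1 = powi (orbi m k). Proof. by []. Qed.

Lemma orbi_gt0 m k : (0 < m)%N -> (0 < orbi m k)%N.
Proof.
by move=> m0; elim: k => // k IH; exact: leq_ltn_trans (powi_gt IH).
Qed.

Lemma orbi_lt m k : (0 < m)%N -> (orbi m k < orbi m k.+1)%N.
Proof. by move=> m0; apply: powi_gt; exact: orbi_gt0. Qed.

Lemma orbi_le m m' k : (m <= m')%N -> (orbi m k <= orbi m' k)%N.
Proof.
move=> mm'; elim: k => // k IH; rewrite -ltnS !orbiS !powiS.
by rewrite leq_exp2r// ltnW.
Qed.

Lemma orbi_ge m k : (0 < m)%N -> (k < orbi m k)%N.
Proof.
by move=> m0; elim: k => [|k IH]; [exact: m0|exact: leq_ltn_trans IH (orbi_lt k m0)].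
Qed.

(** The largest [k] with [2 ^ (b ^ k) <= n], for [n] the integer of index [i]:
taking [b]-th powers raises it by exactly one, so it grades the orbits of
[n |-> n ^ b] other than that of 1. *)
Definition grade (i : nat) : nat := trunc_log b (trunc_log 2 i.+1).

Lemma grade_powi i : (0 < i)%N -> grade (powi i) = (grade i).+1.
Proof.
move=> i0; rewrite /grade powiS; set N := i.+1; set t := trunc_log 2 N.
have b0 : (0 < b)%N by exact: ltnW.
have t0 : (0 < t)%N by rewrite trunc_log_gt0.
have [tN Nt] := andP (trunc_log_bounds (isT : 1 < 2)%N (isT : 0 < N)%N).
have [st ts] := andP (trunc_log_bounds b2 t0).
apply: trunc_log_eq => //; apply/andP; split.
  rewrite expnSr; apply: (@leq_trans (t * b)); first by rewrite leq_pmul2r.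
  by apply: trunc_log_max => //; rewrite expnM leq_exp2r.
rewrite expnSr; apply: (@leq_trans (t.+1 * b)); last by rewrite leq_pmul2r.
rewrite -(@ltn_exp2l 2)// expnM.
apply: leq_ltn_trans (trunc_logP _ _) _; rewrite ?expn_gt0//.
by rewrite ltn_exp2r.
Qed.

Lemma grade_le i : (grade i <= i)%N.
Proof.
rewrite /grade; case: (posnP (trunc_log 2 i.+1)) => [->|t0]; first by rewrite trunc_log0.
rewrite -ltnS; apply: (@leq_ltn_trans (trunc_log 2 i.+1)).
  apply: leq_trans (trunc_logP b2 t0); exact/ltnW/ltn_expl.
apply: leq_trans (trunc_logP (isT : 1 < 2)%N (isT : 0 < i.+1)%N).
exact: ltn_expl.
Qed.

End Indices.

(** * The double commutant as formal power series *)

Section Structure.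

Variables (R : realType) (b : nat) (w : nat -> R[i]).
Local Notation H2 := (dirichletH2 R).
Implicit Types (f x y : H2) (T S : bounded_operator H2).
Variable C : bounded_operator H2.
Hypothesis b2 : (1 < b)%N.
Hypothesis w_neq0 : forall i, w i != 0.
Hypothesis w_anti : forall i j, (i <= j)%N -> normc (w j) <= normc (w i).
Hypothesis w0 : w 0 = 1.
Hypothesis C_powi : forall f i, C f (powi b i) = w i * f i.
Hypothesis C_out : forall f j, (forall i, powi b i <> j) -> C f j = 0.

Local Notation powi := (powi b).
Local Notation orbi := (orbi b).
Local Notation delta := (deltaH2 R).

(** Diagonal entries of the operator that carries the orbit of the index 1 (the
integer 2) to that of [m]; the recursion is what commuting with [C] demands. *)
Fixpoint ratio (m k : nat) : R[i] :=
  if k is k'.+1 then ratio m k' * (w (orbi m k') / w (orbi 1 k')) else 1.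

Lemma ratioS m k :
  ratio m k.+1 = ratio m k * (w (orbi m k) / w (orbi 1 k)).
Proof. by []. Qed.

(** The orbit of [m] lies further out than that of 1, where the weights are
smaller. *)
Lemma normc_ratio m k : (0 < m)%N -> normc (ratio m k) <= 1.
Proof.
move=> m0; elim: k => [|k IH]; first by rewrite normc1.
rewrite ratioS normcM mulr_ile1 ?normc_ge0// normcM normcV.
rewrite ler_pdivrMr ?mul1r; first by apply: w_anti; exact: orbi_le.
by rewrite lt_def normc_ge0 andbT; apply: contra (w_neq0 (orbi 1 k)) => /eqP/eq0_normc ->.
Qed.

(** The restriction of [C] to the orbit of 1 is carried to its restriction to
the orbit of [m]. That the result commutes with [C] on the whole space uses that
the orbit of 1 has no entry from outside. *)
Lemma intertwiner m : (0 < m)%N -> exists X : bounded_operator H2,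
  [/\ forall f k, X f (orbi m k) = ratio m k * f (orbi 1 k),
      forall f j, (forall k, orbi m k <> j) -> X f j = 0 &
      forall f, X (C f) = C (X f)].
Proof.
move=> m0; pose r := floor_inv (orbi m).
have rK k : r (orbi m k) = k by apply: floor_invK => i; exact: orbi_lt.
have [j|i j|X X1 _] := @weighted_substitution_exists R
  (fun j => if orbi m (r j) == j then ratio m (r j) else 0) (fun j => orbi 1 (r j)).
- by case: ifP => _; rewrite ?normc_ratio// normc0.
- case: (eqVneq (orbi m (r i)) i) => [<-|]; last by rewrite eqxx.
  case: (eqVneq (orbi m (r j)) j) => [<-|]; last by rewrite eqxx.
  move=> _ _; rewrite !rK => e; congr (orbi m _).
  exact: (theta_inj (fun k => orbi_lt b2 k (ltn0Sn 0)) e).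
have Xorb f k : X f (orbi m k) = ratio m k * f (orbi 1 k).
  by rewrite X1 rK eqxx.
have Xout f j : (forall k, orbi m k <> j) -> X f j = 0.
  by move=> h; rewrite X1; case: eqP => [/h//|]; rewrite mul0r.
exists X; split => // f; apply: H2_ext => j.
have [[[|k] <-]|nj] := pselect (exists k, orbi m k = j).
- (* 2 is not a [b]-th power, so nothing is mapped to the start of an orbit *)
  rewrite Xorb C_out ?mulr0; last by move=> i; exact: powi_neq1.
  have [[i im]|nm] := pselect (exists i, powi i = orbi m 0).
    rewrite -im C_powi Xout ?mulr0// => k ki.
    have : (i < m)%N.
      rewrite -[m in (_ < m)%N]/(orbi m 0) -im powi_gt//.
      by rewrite -ki orbi_gt0.
    rewrite -ki ltnNge; apply/negP/negPn.
    by elim: (k) => // l IH; exact: leq_trans IH (ltnW (orbi_lt b2 l m0)).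
  by rewrite C_out// => i im; apply: nm; exists i.
- rewrite Xorb !orbiS !C_powi Xorb ratioS.
  by field; exact: w_neq0.
- rewrite Xout; last by move=> k kj; apply: nj; exists k.
  have [[i ij]|ni] := pselect (exists i, powi i = j).
    rewrite -ij C_powi Xout ?mulr0// => k ki.
    by apply: nj; exists k.+1; rewrite orbiS ki.
  by rewrite C_out// => i ij; apply: ni; exists i.
Qed.

Lemma delta_at k j : delta k j = (j == k)%:R. Proof. by []. Qed.

Lemma C_delta i : C (delta i) = w i *: delta (powi i).
Proof.
apply: H2_ext => j; rewrite coefsZ !delta_at.
have [[l <-]|nj] := pselect (exists l, powi l = j).
  rewrite C_powi delta_at (inj_eq (powi_inj b2)).
  by case: eqP => [->|]; rewrite ?mulr0.
rewrite C_out; last by move=> l lj; apply: nj; exists l.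
by case: eqP => [ji|]; rewrite ?mulr0//; case: nj; exists i.
Qed.

Lemma iter_C_delta k i : exists2 c : R[i], c != 0 &
  iter k C (delta i) = c *: delta (orbi i k).
Proof.
elim: k => [|k [c c0 IH]]; first by exists 1; rewrite ?oner_eq0 ?scale1r.
exists (c * w (orbi i k)); first by rewrite mulf_neq0.
by rewrite iterS IH bopZ C_delta scalerA orbiS.
Qed.

Lemma coord0_projection : exists2 E : bounded_operator H2,
  (forall x, E x = x 0 *: delta 0) & (forall x, E (C x) = C (E x)).
Proof.
have [E hE _] := bop_mask R (fun i => i == 0%N).
have EE x : E x = x 0 *: delta 0.
  apply: H2_ext => l; rewrite hE coefsZ delta_at.
  by case: eqP => [->|]; rewrite ?mulr1 ?mulr0.
have C0 x : C x 0 = x 0 by have := C_powi x 0; rewrite w0 mul1r powi0.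
by exists E => // x; rewrite !EE bopZ C_delta w0 scale1r powi0 C0.
Qed.

Section Bicommutant.
Variable T : bounded_operator H2.
Hypothesis T_bicomm : commutant (commutant [set C]) T.

Lemma bicommutant_comm S : (forall x, S (C x) = C (S x)) -> forall x, T (S x) = S (T x).
Proof.
by move=> h x; apply: T_bicomm => U -> y; exact: h.
Qed.

(** The coefficients are read off from [T (delta 1)], and the intertwiners
carry them to the other basis vectors. In the coordinate [j] the powers of [C]
from the [j]-th on contribute nothing, which is why the finite sums do not depend on
[n]. *)
Lemma bicommutant_power_series : exists a : nat -> R[i],
  forall x j n, (0 < j)%N -> (j <= n)%N ->
  T x j = \sum_(i < n) a i * iter i C x j.
Proof.
have /choice[c hc] k : exists c : R[i],
    c != 0 /\ iter k C (delta 1) = c *: delta (orbi 1 k).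
  by have [c c0 h] := iter_C_delta k 1; exists c.
pose a k := T (delta 1) (orbi 1 k) / c k; exists a => x j n j0 jn.
have [P hP] := bop_iter_sum C a n.
suff h m : T (delta m) j = P (delta m) j.
  rewrite (coord_ext h x) hP coefs_sum; apply: eq_bigr => i _.
  by rewrite coefsZ.
rewrite hP coefs_sum.
case: (posnP m) => [->|m0].
  (* both sides vanish at j: the line of delta 0 is fixed by C, and it is
     invariant under T as the range of a projection commuting with C *)
  have [E hE EC] := coord0_projection.
  have Ed : E (delta 0) = delta 0 by rewrite hE delta_at scale1r.
  have -> : T (delta 0) j = 0.
    by rewrite -Ed (bicommutant_comm EC) hE coefsZ delta_at gtn_eqF// mulr0.
  rewrite big1// => i _.
  suff -> : iter i C (delta 0) = delta 0.
    by rewrite coefsZ delta_at gtn_eqF// mulr0.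
  by elim: (nat_of_ord i) => //= k ->; rewrite C_delta w0 scale1r powi0.
have [X [Xorb Xout XC]] := intertwiner m0.
have Xd : X (delta 1) = delta m.
  apply: H2_ext => l; rewrite delta_at.
  have [[k <-]|nl] := pselect (exists k, orbi m k = l); last first.
    rewrite Xout; last by move=> k kl; apply: nl; exists k.
    by case: eqP => // lm; case: nl; exists 0%N.
  have at_start i : (0 < i)%N -> (orbi i k == i) = (k == 0)%N.
    move=> i0; rewrite -[X in _ == X]/(orbi i 0).
    by rewrite (inj_eq (theta_inj (fun k => orbi_lt b2 k i0))).
  rewrite Xorb delta_at !at_start//.
  by case: eqP => [->|]; rewrite ?mulr0 ?mul1r.
rewrite -Xd (bicommutant_comm XC).
under eq_bigr => i _ do rewrite coefsZ -iter_comm// (hc i).2 bopZ coefsZ.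
have [[k kj]|nj] := pselect (exists k, orbi m k = j); last first.
  have nj' k : orbi m k <> j by move=> kj; apply: nj; exists k.
  by rewrite Xout// big1// => i _; rewrite Xout// !mulr0.
have kn : (k < n)%N by apply: leq_trans jn; rewrite -kj orbi_ge.
rewrite -kj Xorb (bigD1 (Ordinal kn))//= big1 ?addr0.
  rewrite Xorb delta_at eqxx mulr1 /a mulrA divfK ?(hc k).1//.
  by rewrite mulrC.
move=> i ik; rewrite Xorb delta_at.
rewrite (inj_eq (theta_inj (fun k => orbi_lt b2 k (ltn0Sn 0)))).
case: eqP => [e|]; last by rewrite !mulr0.
by rewrite -val_eqE /= e eqxx in ik.
Qed.

Lemma bicommutant_at0 x : T x 0 = T (delta 0) 0 * x 0.
Proof.
have [E hE EC] := coord0_projection.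
have -> : T x 0 = E (T x) 0 by rewrite hE coefsZ delta_at mulr1.
by rewrite -(bicommutant_comm EC) hE bopZ coefsZ mulrC.
Qed.

End Bicommutant.
End Structure.

(** * Fejer means and grade windows *)

Section Fejer.

Variables (R : realType) (b : nat) (w : nat -> R[i]).
Local Notation H2 := (dirichletH2 R).
Implicit Types (f x y : H2) (S : bounded_operator H2).
Variable C : bounded_operator H2.
Hypothesis b2 : (1 < b)%N.
Hypothesis w0 : w 0 = 1.
Hypothesis C_powi : forall f i, C f (powi b i) = w i * f i.
Hypothesis C_out : forall f j, (forall i, powi b i <> j) -> C f j = 0.
Hypothesis C_contr : forall f, l2norm (C f) <= l2norm f.

Local Notation powi := (powi b).
Local Notation grade := (grade b).

Lemma cvg_partial f : (series (sqnorms f) @ \oo --> l2norm f ^+ 2)%classic.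
Proof.
rewrite sqr_sqrtr; first exact: (H2P f).
apply: limr_ge; first exact: H2P.
by apply: nearW => n; exact: series_sqnorms_ge0.
Qed.

Lemma sum_sqnorm_le (z : nat -> H2) L (B : R) :
  (forall N, \sum_(0 <= l < L) series (sqnorms (z l)) N <= B) ->
  \sum_(0 <= l < L) l2norm (z l) ^+ 2 <= B.
Proof.
move=> h.
have c : ((\sum_(0 <= l < L) series (sqnorms (z l)) N) @[N --> \oo] -->
    \sum_(0 <= l < L) l2norm (z l) ^+ 2)%classic.
  elim: (L) => [|k IH].
    by under eq_cvg do rewrite big_geq//; rewrite big_geq//; exact: cvg_cst.
  under eq_cvg do rewrite big_nat_recr//=.
  by rewrite big_nat_recr//=; have := cvgD IH (@cvg_partial (z k)); exact.
rewrite -(cvg_lim (@Rhausdorff _) c); apply: limr_le; last exact: nearW.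
by apply/cvg_ex; eexists; exact: c.
Qed.

Lemma C_at0 x : C x 0 = x 0.
Proof. by have := C_powi x 0; rewrite w0 mul1r powi0. Qed.

Lemma iterC_at0 k x : iter k C x 0 = x 0.
Proof. by elim: k => //= k IH; rewrite C_at0 IH. Qed.

Lemma iterC_low_grade k x j : (0 < j)%N -> (grade j < k)%N -> iter k C x j = 0.
Proof.
elim: k j => [|k IH] j j0 //; rewrite iterS.
have [[i ij]|ni] := pselect (exists i, powi i = j); last first.
  by move=> _; rewrite C_out// => i ij; apply: ni; exists i.
have i0 : (0 < i)%N by rewrite lt0n; apply: contraTneq j0 => i0; rewrite -ij i0 powi0.
by rewrite -ij C_powi grade_powi// ltnS => /(IH _ i0) ->; rewrite mulr0.
Qed.

Lemma sum_window (A B L : nat) :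
  (\sum_(0 <= l < L) (A <= l < B) = minn B L - A)%N.
Proof.
elim: L => [|L IH]; first by rewrite big_geq// minn0.
rewrite big_nat_recr//= IH.
by case: (leqP A L) => AL; case: (ltnP L B) => LB /=; lia.
Qed.

Variable n : nat.
Hypothesis n0 : (0 < n)%N.

(** The indices other than 0 whose grade lies in the window ]l - n, l]; every
such index lies in exactly [n] of these sets. *)
Definition window (l i : nat) : bool := (0 < i)%N && (grade i <= l < grade i + n)%N.

Variable P : nat -> bounded_operator H2.
Hypothesis P_window : forall l x j, P l x j = if window l j then x j else 0.

Lemma iterC_window k l x j : (0 < j)%N -> iter k C (P l x) j =
  if (k <= grade j)%N && (grade j - k <= l < grade j - k + n)%N
  then iter k C x j else 0.
Proof.
elim: k j => [|k IH] j j0.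
  by rewrite /= P_window /window j0 subn0.
rewrite !iterS.
have [[i ij]|ni] := pselect (exists i, powi i = j); last first.
  rewrite !C_out; [by case: ifP| |].
  - by move=> i ij; apply: ni; exists i.
  - by move=> i ij; apply: ni; exists i.
have i0 : (0 < i)%N by rewrite lt0n; apply: contraTneq j0 => i0; rewrite -ij i0 powi0.
rewrite -ij !C_powi grade_powi// IH// ltnS subSS.
by case: ifP; rewrite ?mulr0.
Qed.

Lemma sum_window_norm_le x L :
  \sum_(0 <= l < L) l2norm (P l x) ^+ 2 <= n%:R * l2norm x ^+ 2.
Proof.
apply: (@sum_sqnorm_le (fun l => P l x)) => N.
apply: (@le_trans _ _ (n%:R * series (sqnorms x) N)); last first.
  by rewrite ler_wpM2l// le_partial.
rewrite seriesEnat /= mulr_sumr.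
under eq_bigr do rewrite seriesEnat /=.
rewrite exchange_big /=; apply: ler_sum => j _.
rewrite (eq_bigr (fun l => (window l j)%:R * sqnorms x j)); last first.
  move=> l _; rewrite /sqnorms P_window; case: ifP => _; first by rewrite mul1r.
  by rewrite normc0 expr0n mul0r.
rewrite -mulr_suml ler_wpM2r ?sqr_ge0// -natr_sum ler_nat /window.
case: (posnP j) => j0; first by rewrite /= big1.
by rewrite sum_window; lia.
Qed.

Variables (T : bounded_operator H2) (a : nat -> R[i]).
Hypothesis T_series : forall x j m, (0 < j)%N -> (j <= m)%N ->
  T x j = \sum_(i < m) a i * iter i C x j.

(** [C^k] raises grades by [k], so its entries survive in exactly [n - k] of
the compressions to windows: averaging these compressions of [T] over the windows
multiplies the [k]-th coefficient by the Fejer weight [(n - k) / n]. *)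
Lemma fejer_compression x j L : (0 < j)%N -> (grade j + n <= L)%N ->
  \sum_(0 <= l < L) (if window l j then T (P l x) j else 0) =
  \sum_(k < n) (n - k)%:R * a k * iter k C x j.
Proof.
move=> j0 gL.
have jm : (j <= n + j)%N by rewrite leq_addl.
rewrite (eq_bigr (fun l => \sum_(k < n + j)
    (window l j && (k <= grade j)%N && (grade j - k <= l < grade j - k + n)%N)%:R *
    (a k * iter k C x j))); last first.
  move=> l _; rewrite (T_series _ j0 jm) /=.
  case: ifP => wl /=; last by rewrite big1// => k _; rewrite mul0r.
  apply: eq_bigr => k _; rewrite iterC_window//.
  by case: ifP => _; rewrite ?mul1r// mul0r mulr0.
rewrite exchange_big /=.
rewrite (big_ord_widen (n + j) (fun k => (n - k)%:R * a k * iter k C x j)) ?leq_addr//.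
rewrite [RHS]big_mkcond /=; apply: eq_bigr => k _.
rewrite -mulr_suml -natr_sum.
case: (ltnP (grade j) k) => gk.
  by rewrite iterC_low_grade// !mulr0; case: ifP.
have -> : (\sum_(0 <= l < L) [&& window l j && true &
    grade j - k <= l < grade j - k + n] = n - k)%N.
  rewrite (eq_bigr (fun l => nat_of_bool (grade j <= l < grade j - k + n)%N)).
    by rewrite sum_window; lia.
  by move=> l _; rewrite /window j0 /=; congr nat_of_bool; lia.
by case: ltnP => nk; [rewrite mulrA|rewrite (eqP nk) !mul0r].
Qed.

(** A coordinate receives contributions from at most [n] windows, so by
Cauchy-Schwarz the square of their average is at most [1 / n] times the sum of
the squares; on the other side the windows cover each index at most [n] times,
and the two factors cancel. *)
Lemma fejer_norm_le (M : R) x : 0 <= M -> (forall y, l2norm (T y) <= M * l2norm y) ->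
  forall J, \sum_(0 <= j < J) (if (0 < j)%N then
     normc (\sum_(k < n) ((n - k)%:R / n%:R) * a k * iter k C x j) ^+ 2 else 0)
  <= (M * l2norm x) ^+ 2.
Proof.
move=> M0 hM J; pose L := (J + n)%N.
have n0R : 0 < n%:R :> R by rewrite ltr0n.
have coord j : (0 < j)%N -> (j < J)%N ->
    normc (\sum_(k < n) ((n - k)%:R / n%:R) * a k * iter k C x j) ^+ 2 <=
    n%:R^-1 * \sum_(0 <= l < L) normc (T (P l x) j) ^+ 2.
  move=> j0 jJ.
  have -> : \sum_(k < n) ((n - k)%:R / n%:R) * a k * iter k C x j =
      n%:R^-1 * \sum_(0 <= l < L) (if window l j then T (P l x) j else 0).
    rewrite fejer_compression//; last first.
      by rewrite /L leq_add2r (leq_trans (grade_le b2 j))// ltnW.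
    by rewrite mulr_sumr; apply: eq_bigr => k _; rewrite !mulrA [_^-1 * _]mulrC.
  rewrite normcM exprMn normcV (_ : normc n%:R = n%:R); last first.
    by rewrite -(rmorph_nat (real_complex R)) normcC ger0_norm.
  rewrite expr2 -mulrA ler_wpM2l ?invr_ge0 ?ler0n//.
  rewrite mulrC ler_pdivrMr//.
  apply: (@le_trans _ _ ((\sum_(0 <= l < L) (window l j)%:R * normc (T (P l x) j)) ^+ 2)).
    rewrite ler_pXn2r ?nnegrE ?normc_ge0//; last first.
      by apply: sumr_ge0 => l _; rewrite mulr_ge0 ?normc_ge0.
    apply: le_trans (normc_sum _ _ _) _; apply: ler_sum => l _.
    by case: ifP; rewrite ?mul1r ?normc0 ?mul0r.
  apply: le_trans (sum_cauchy_schwarz _ _ _ _) _ => //.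
    by move=> l; exact: normc_ge0.
  rewrite mulrC ler_wpM2l//; first by apply: sumr_ge0 => l _; exact: sqr_ge0.
  rewrite (eq_bigr (fun l => (window l j)%:R)); last first.
    by move=> l _; case: window; rewrite ?expr1n ?expr0n.
  by rewrite -natr_sum ler_nat /window j0 /= sum_window; lia.
apply: (@le_trans _ _ (\sum_(0 <= j < J)
    n%:R^-1 * \sum_(0 <= l < L) normc (T (P l x) j) ^+ 2)).
  rewrite big_nat_cond [leRHS]big_nat_cond; apply: ler_sum => j /andP[/andP[_ jJ] _].
  case: ifP => j0; first exact: coord.
  rewrite mulr_ge0 ?invr_ge0 ?ler0n// sumr_ge0// => l _; exact: sqr_ge0.
rewrite -mulr_sumr exchange_big /= ler_pdivrMl//.
apply: (@le_trans _ _ (\sum_(0 <= l < L) M ^+ 2 * l2norm (P l x) ^+ 2)).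
  apply: ler_sum => l _; rewrite -exprMn.
  apply: (@le_trans _ _ (l2norm (T (P l x)) ^+ 2)).
    by have := le_partial (T (P l x)) J; rewrite seriesEnat.
  by rewrite ler_pXn2r ?nnegrE ?mulr_ge0 ?l2norm_ge0.
rewrite -mulr_sumr exprMn mulrCA ler_wpM2l ?sqr_ge0//.
exact: sum_window_norm_le.
Qed.

End Fejer.

(** * The double commutant property *)

Section DoubleCommutant.

Variables (R : realType) (b : nat) (w : nat -> R[i]).
Local Notation H2 := (dirichletH2 R).
Implicit Types (f x y : H2) (S : bounded_operator H2).
Variable C : bounded_operator H2.
Hypothesis b2 : (1 < b)%N.
Hypothesis w_neq0 : forall i, w i != 0.
Hypothesis w_anti : forall i j, (i <= j)%N -> normc (w j) <= normc (w i).
Hypothesis w0 : w 0 = 1.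
Hypothesis C_powi : forall f i, C f (powi b i) = w i * f i.
Hypothesis C_out : forall f j, (forall i, powi b i <> j) -> C f j = 0.
Hypothesis C_contr : forall f, l2norm (C f) <= l2norm f.

Local Notation WOT := (weak_operator_topology (@H2dot R)).
Local Notation at0 := (C_at0 w0 C_powi).

Lemma iterC_contr k x : l2norm (iter k C x) <= l2norm x.
Proof. by elim: k => //= k IH; exact: le_trans (C_contr _) IH. Qed.

(** [p(C)] can be corrected at the fixed vector [delta 0] at no cost: adding
[(l - p(1)) C^N] changes the eigenvalue there to [l], while [C^N] tends weakly
to 0 on the complement. *)
Lemma polynomial_with_eigenvalue (p : {poly R[i]}) n (l : R[i]) S :
  (size p <= n)%N ->
  (forall x j, S x j = if j == 0%N then l * x 0%N
                       else \sum_(k < n) p`_k * iter k C x j) ->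
  closure (poly_alg C : set WOT) S.
Proof.
move=> pn hS; pose mu := l - \sum_(k < n) p`_k.
pose q N := p + mu *: 'X^N.
have /choice[Q hQ] N : exists Q : bounded_operator H2,
    forall x, Q x = \sum_(k < n) p`_k *: iter k C x + mu *: iter N C x.
  have [U hU] := bop_iter_sum C (fun k => p`_k) n.
  have [V hV] := bop_iter C N; have [W hW] := bop_scale mu V.
  by have [Z hZ] := bop_add U W; exists Z => x; rewrite hZ hU hW hV.
have Qalg N : poly_alg C (Q N).
  apply: (@poly_algP _ _ _ (q N) (n + N.+1)).
    rewrite /q (leq_trans (size_polyD _ _))// geq_max (leq_trans pn) ?leq_addr//=.
    by rewrite (leq_trans (size_scale_leq _ _))// size_polyXn leq_addl.
  move=> x; rewrite hQ (big_ord_widen (n + N.+1) (fun k => p`_k *: iter k C x)) ?leq_addr//.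
  have Nlt : (N < n + N.+1)%N by rewrite addnS ltnS leq_addl.
  rewrite big_mkcond /= -[X in _ = X]addr0.
  have -> : mu *: iter N C x = \sum_(k < n + N.+1) (if k == Ordinal Nlt then mu *: iter k C x else 0).
    by rewrite -big_mkcond big_pred1_eq.
  rewrite addr0 -big_split /=; apply: eq_bigr => k _.
  have -> : (if (k < n)%N then p`_k *: iter k C x else 0) = p`_k *: iter k C x.
    case: ltnP => // nk; rewrite nth_default ?scale0r//.
    exact: leq_trans pn nk.
  have -> : (if k == Ordinal Nlt then mu *: iter k C x else 0) =
      (mu * (k == N :> nat)%:R) *: iter k C x.
    by rewrite -val_eqE /=; case: eqP => _; rewrite ?mulr1// mulr0 scale0r.
  by rewrite /q coefD coefZ coefXn scalerDl.
apply: (closure_WOT_seq (Tn := Q)).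
  by move=> N; apply: subset_closure; exact: Qalg.
move=> x y; have [U hU] := bop_iter_sum C (fun k => p`_k) n.
apply: (@weak_cvg _ _ _ (l2norm (U x) + normc mu * l2norm x)).
  move=> N; rewrite hQ -hU (le_trans (H2norm_triangle _ _))// lerD2l.
  by rewrite H2norm_scale ler_wpM2l ?normc_ge0// iterC_contr.
move=> j; apply/cvgcP => e e0; exists (grade b j).+1 => // N /= jN.
suff -> : Q N x j = S x j by rewrite subrr normc0.
rewrite hQ coefsD coefs_sum coefsZ hS; under eq_bigr do rewrite coefsZ.
case: (posnP j) => [->|j0].
  rewrite (iterC_at0 w0 C_powi); under eq_bigr do rewrite (iterC_at0 w0 C_powi).
  by rewrite -mulr_suml -mulrDl /mu addrC subrK.
by rewrite (iterC_low_grade b2 C_powi C_out)// mulr0 addr0.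
Qed.

(** The Fejer means with eigenvalue corrected at [delta 0] are norm bounded and
converge to [T] in each coordinate, hence weakly. *)
Lemma bicommutant_subset_closure :
  commutant (commutant [set C]) `<=` closure (poly_alg C : set WOT).
Proof.
move=> T TC.
have [a Ta] := bicommutant_power_series b2 w_neq0 w_anti w0 C_powi C_out TC.
have T0 := bicommutant_at0 b2 w0 C_powi C_out TC.
set l := T _ 0%N in T0.
have [M M0 hM] := bop_bound T.
pose c n k : R[i] := (n.+1 - k)%:R / n.+1%:R * a k.
have [E hE Enorm] := bop_mask R (fun i => i == 0%N).
have [K hK _] := bop_mask R (fun i => i != 0%N).
have /choice[S hS] n : exists S : bounded_operator H2, forall x j, S x j =
    if j == 0%N then l * x 0%N else \sum_(k < n.+1) c n k * iter k C x j.
  have [U hU] := bop_iter_sum C (c n) n.+1; have [V hV] := bop_comp K U.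
  have [W hW] := bop_scale l E; have [Z hZ] := bop_add W V.
  exists Z => x j; rewrite hZ coefsD hW coefsZ hE hV hK hU coefs_sum.
  under eq_bigr do rewrite coefsZ.
  case: (eqVneq j 0%N) => [->|_] /=; first by rewrite addr0.
  by rewrite mulr0 add0r.
have Scl n : closure (poly_alg C : set WOT) (S n).
  apply: (@polynomial_with_eigenvalue (\poly_(k < n.+1) c n k) n.+1 l).
    exact: size_poly.
  move=> x j; rewrite hS; case: ifP => // _; apply: eq_bigr => k _.
  by rewrite coef_poly ltn_ord.
apply: (closure_WOT_seq (Tn := S)) => // x y.
apply: (@weak_cvg _ _ _ (normc l * l2norm x + M * l2norm x)).
  move=> n.
  have /choice[P hP] m : exists P : bounded_operator H2,
      forall x j, P x j = if window b n.+1 m j then x j else 0.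
    by have [P hP _] := bop_mask R (window b n.+1 m); exists P.
  have fejer := fejer_norm_le b2 C_powi C_out (ltn0Sn n) hP Ta x M0 hM.
  have -> : S n x = E (S n x) + K (S n x).
    apply: H2_ext => j; rewrite coefsD hE hK.
    by case: eqP => _ /=; rewrite ?addr0 ?add0r.
  rewrite (le_trans (H2norm_triangle _ _))// lerD//.
    have -> : E (S n x) = l *: E x.
      by apply: H2_ext => j; rewrite coefsZ !hE hS; case: eqP => [->|]; rewrite ?mulr0.
    by rewrite H2norm_scale ler_wpM2l ?normc_ge0.
  apply: le_H2norm; first by rewrite mulr_ge0 ?l2norm_ge0.
  move=> J; apply: le_trans (fejer J); rewrite seriesEnat /=.
  apply: ler_sum => j _; rewrite /sqnorms hK hS lt0n.
  case: (eqVneq j 0%N) => _; last exact: lexx.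
  by rewrite [~~ true]/= normc0 expr0n.
move=> j.
case: (posnP j) => [->|j0].
  under eq_cvg do rewrite hS eqxx -T0.
  exact: cvg_cst.
pose v k := a k * iter k C x j.
pose B := \sum_(k < j.+1) k%:R * normc (v k).
have B0 : 0 <= B by apply: sumr_ge0 => k _; rewrite mulr_ge0 ?normc_ge0.
apply/cvgcP => e e0.
have [N hN] : exists N, forall n, (N <= n)%N -> B / n.+1%:R < e.
  have Be : 0 <= B / e by rewrite divr_ge0// ltW.
  exists (Num.bound (B / e)) => n Nn.
  rewrite ltr_pdivrMr// mulrC -ltr_pdivrMr//.
  by rewrite (lt_le_trans (archi_boundP Be))// ler_nat leqW.
exists (maxn N j) => // n /=; rewrite geq_max => /andP[Nn jn].
apply: le_lt_trans (hN n Nn).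
have vj k : (j < k)%N -> v k = 0.
  by move=> jk; rewrite /v (iterC_low_grade b2 C_powi C_out) ?mulr0// (leq_ltn_trans (grade_le b2 j)).
rewrite (Ta x j j.+1)// hS gtn_eqF//.
have -> : \sum_(k < n.+1) c n k * iter k C x j = \sum_(k < j.+1) c n k * iter k C x j.
  rewrite [RHS](big_ord_widen n.+1 (fun k => c n k * iter k C x j)) ?ltnS//.
  rewrite [RHS]big_mkcond /=; apply: eq_bigr => k _; case: ltnP => // jk.
  by rewrite -[c n k * _]mulrA [X in _ * X](vj k jk) mulr0.
rewrite -sumrB /B mulr_suml (le_trans (normc_sum _ _ _))//; apply: ler_sum => k _.
have nR : n.+1%:R != 0 :> R[i] by rewrite pnatr_eq0.
have -> : a k * iter k C x j - c n k * iter k C x j = (k%:R / n.+1%:R) * v k.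
  have kn : (k <= n.+1)%N by rewrite (leq_trans (ltnW (ltn_ord k)))// ltnS.
  rewrite /c /v natrB//; field.
  by rewrite -natr1 in nR.
rewrite normcM mulrAC ler_wpM2r ?normc_ge0// normcM normcV.
have nn m : normc (m%:R : R[i]) = m%:R.
  by rewrite -(rmorph_nat (real_complex R)) normcC ger0_norm.
by rewrite !nn.
Qed.

Theorem double_commutant : double_commutant_property (@H2dot R) C.
Proof.
apply/seteqP; split; last exact: bicommutant_subset_closure.
exact: closure_WOT_bicommutant.
Qed.

End DoubleCommutant.

(** * Dirichlet series *)

Section DirichletSeries.

Variable R : realType.
Local Notation H2 := (dirichletH2 R).
Implicit Types (f g h x y : H2) (s z : R[i]).

Lemma cexpD z s : cexp (z + s) = cexp z * cexp s.
Proof.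
case: z s => [a b] [c d]; rewrite /cexp /= expRD cosD sinD rmorphM.
apply/eqP; rewrite eq_complex /=; apply/andP; split; apply/eqP; ring.
Qed.

Lemma cexp0 : cexp 0 = 1 :> R[i].
Proof. by rewrite /cexp /= expR0 cos0 sin0 mul1r. Qed.

Lemma normc_cexp z : normc (cexp z) = expR (complex.Re z).
Proof.
rewrite /cexp normcM normcC ger0_norm ?expR_ge0//.
by rewrite [X in _ * X]/= cos2Dsin2 sqrtr1 mulr1.
Qed.

Lemma cexp_neq0 z : cexp z != 0.
Proof.
apply: contraTneq (expR_gt0 (complex.Re z)) => z0.
by rewrite -normc_cexp z0 normc0 ltxx.
Qed.

Lemma normc_natcpow (n : nat) s :
  normc (natcpow n s) = expR (complex.Re s * ln n%:R).
Proof.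
rewrite /natcpow normc_cexp; congr expR.
by case: s => a b /=; rewrite mulr0 subr0.
Qed.

Lemma natcpow1 s : natcpow 1 s = 1.
Proof. by rewrite /natcpow ln1 mulr0 cexp0. Qed.

Lemma natcpowD n s z : natcpow n (s + z) = natcpow n s * natcpow n z.
Proof. by rewrite /natcpow mulrDl cexpD. Qed.

Lemma natcpow_exp n b s : (0 < n)%N ->
  natcpow (n ^ b) s = natcpow n (b%:R * s).
Proof.
move=> n0; rewrite /natcpow natrX lnXn ?ltr0n//; congr cexp.
by rewrite rmorphMn /= -mulr_natl mulrA [s * _]mulrC.
Qed.

Lemma natcpow_negnat n k : natcpow n.+1 (- k%:R) = ((n.+1%:R ^- k : R)%:C).
Proof.
have -> : - k%:R = k%:R * (-1) :> R[i] by rewrite mulrN1.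
rewrite -natcpow_exp// /natcpow mulN1r.
rewrite /cexp /= oppr0 cos0 sin0.
rewrite expRN lnK; last by rewrite posrE ltr0n expn_gt0.
by rewrite natrX [X in _ * X](_ : _ = 1) ?mulr1.
Qed.

Section CompositionOperator.
Variables (b : nat) (c : R[i]).
Hypothesis b2 : (1 < b)%N.
Hypothesis Re_c : 0 <= complex.Re c.

(** The composition operator maps [deltaH2 R i] to
[weight i *: deltaH2 R (powi b i)]. *)
Definition weight (i : nat) : R[i] := natcpow i.+1 (- c).

Lemma weight_neq0 i : weight i != 0.
Proof. exact: cexp_neq0. Qed.

Lemma weight0 : weight 0 = 1.
Proof. exact: natcpow1. Qed.

Lemma normc_weight_anti i j : (i <= j)%N -> normc (weight j) <= normc (weight i).
Proof.
move=> ij; rewrite !normc_natcpow ler_expR.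
have -> : complex.Re (- c) = - complex.Re c by case: (c).
by rewrite !mulNr lerN2 ler_wpM2l// ler_ln ?posrE ?ltr0n// ler_nat.
Qed.

Lemma normc_weight_le1 i : normc (weight i) <= 1.
Proof. by rewrite -(normc1 R) -weight0 normc_weight_anti. Qed.

Lemma composition_operator_exists : exists C : bounded_operator H2,
  [/\ forall f i, C f (powi b i) = weight i * f i,
      forall f j, (forall i, powi b i <> j) -> C f j = 0 &
      forall f, l2norm (C f) <= l2norm f].
Proof.
pose r := floor_inv (powi b).
have rK i : r (powi b i) = i := floor_invK (powi_lt b2) i.
have [j|i j|C CE Cn] := @weighted_substitution_exists R
  (fun j => if powi b (r j) == j then weight (r j) else 0) r.
- by case: ifP => _; rewrite ?normc_weight_le1 ?normc0.
- case: (eqVneq (powi b (r i)) i) => [<-|]; last by rewrite eqxx.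
  case: (eqVneq (powi b (r j)) j) => [<-|]; last by rewrite eqxx.
  by rewrite !rK => _ _ ->.
exists C; split => //.
- by move=> f i; rewrite CE rK eqxx.
- by move=> f j h; rewrite CE; case: eqP => [/h//|]; rewrite mul0r.
Qed.

Lemma lim_eq (u v : nat -> R[i]^o) :
  (forall l : R[i]^o, (u @ \oo --> l)%classic <-> (v @ \oo --> l)%classic) ->
  limn u = limn v.
Proof.
move=> uv; rewrite /lim; congr (get _).
by apply/funext => l; apply/propext; exact: uv.
Qed.

Lemma cvg_reindex (u : nat -> R[i]^o) (sg : nat -> nat) (l : R[i]^o) :
  (forall K, exists N, forall n, (N <= n)%N -> (K <= sg n)%N) ->
  (u @ \oo --> l)%classic -> ((u \o sg) @ \oo --> l)%classic.
Proof.
move=> h ul; apply: cvg_comp ul => A [K _ KA].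
by have [N hN] := h K; exists N => // n /= Nn; apply: KA; exact: hN.
Qed.

(** The series of [C f] is that of [f] at the image point with zero terms
inserted, so each sequence of partial sums is a reindexing of the other, and the
two have the same limits. *)
Lemma composition_eval (C : bounded_operator H2) :
  (forall f i, C f (powi b i) = weight i * f i) ->
  (forall f j, (forall i, powi b i <> j) -> C f j = 0) ->
  is_composition_operator (fun s => b%:R * s + c) C.
Proof.
move=> Cpow Cout f s _; rewrite /dirichlet_eval.
set u := series _; set v := series _.
have uv N : u N = v (floor_inv (powi b) N).
  elim: N => [|N IH]; first by rewrite /u /v !seriesEnat /= !big_geq.
  rewrite /u seriesSr -/u IH /=; case: eqP => [e|ne].
    rewrite [in RHS]/v seriesSr -/v; congr (_ + _).
    rewrite -e floor_invK; last exact: powi_lt.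
    rewrite Cpow powiS natcpow_exp// mulrAC [RHS]mulrC; congr (_ * _).
    by rewrite /weight -natcpowD; congr natcpow; ring.
  rewrite Cout ?mul0r ?addr0 ?add0r// => i iN; apply: ne.
  by rewrite -iN floor_invK//; exact: powi_lt.
apply: lim_eq => l; split => h.
  have -> : v = u \o powi b.
    by apply/funext => n /=; rewrite uv floor_invK//; exact: powi_lt.
  apply: cvg_reindex h => K; exists K.+1 => n Kn.
  by apply: leq_trans (ltnW Kn) (ltnW (powi_gt b2 _)); exact: leq_trans Kn.
have -> : u = v \o floor_inv (powi b) by apply/funext => n /=; exact: uv.
apply: cvg_reindex h => K; exists (powi b K).+1 => n Kn.
by rewrite ltnW// floor_invP//; exact: powi_lt.
Qed.

End CompositionOperator.

Lemma sum_inv_sqr_le N : \sum_(0 <= n < N) (n.+1%:R ^- 2 : R) <= 2.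
Proof.
case: N => [|N]; first by rewrite big_geq.
(* this stronger bound passes from N to N + 1 because
   1 / (N + 1)^2 <= 1 / N - 1 / (N + 1) *)
apply: (@le_trans _ _ (2 - N.+1%:R^-1)); last by rewrite gerBl invr_ge0.
elim: N => [|N IH]; first by rewrite big_nat1 expr1n invr1; lra.
rewrite big_nat_recr//=; apply: (le_trans (lerD IH (lexx _))).
have N0 : 0 < N.+1%:R :> R by rewrite ltr0n.
have -> : N.+2%:R = N.+1%:R + 1 :> R by rewrite -[in LHS]addn1 natrD.
set t : R := N.+1%:R in N0 *.
rewrite -subr_ge0.
have -> : 2 - (t + 1)^-1 - (2 - t^-1 + (t + 1) ^- 2) = (t * (t + 1) ^+ 2)^-1.
  by field; rewrite !gt_eqF//; lra.
by rewrite invr_ge0 mulr_ge0 ?sqr_ge0// ltW.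
Qed.

Lemma H2dotC f g : H2dot g f = (H2dot f g)^*.
Proof.
apply: limc_eq; apply/cvgcP => e e0.
have /cvgcP/(_ e e0)[N _ hN] := @H2dot_cvg R f g.
exists N => // n /hN /=; rewrite -[X in X < e -> _]normc_conj rmorphB /=.
congr (normc (_ - _) < e); rewrite !seriesEnat /= rmorph_sum.
by apply: eq_bigr => i _; rewrite rmorphM /= conjCK mulrC.
Qed.

Lemma conj_real (r : R) : (r%:C)^* = r%:C :> R[i].
Proof. by apply/eqP; rewrite eq_complex /= oppr0 !eqxx. Qed.

(** Up to the factor [m.+1 ^ k], these are the entries [n.+1 ^- k] from the index
[m] on. The norm bound does not depend on [k], as the ratios are at most 1. *)
Lemma power_vector_exists m k : (0 < k)%N -> exists2 x : H2,
  (forall n, x n = ((if (m <= n)%N then (m.+1%:R / n.+1%:R) ^+ k else 0) : R)%:C) &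
  l2norm x <= m.+1%:R * 2.
Proof.
move=> k0.
apply: (@H2_exists _ (fun n => ((if (m <= n)%N then (m.+1%:R / n.+1%:R) ^+ k else 0) : R)%:C)).
  by rewrite mulr_ge0.
move=> N; rewrite seriesEnat /=.
apply: (@le_trans _ _ (m.+1%:R ^+ 2 * 2)); last first.
  by rewrite exprMn ler_wpM2l ?sqr_ge0// expr2; lra.
apply: le_trans (ler_wpM2l (sqr_ge0 _) (sum_inv_sqr_le N)).
rewrite mulr_sumr; apply: ler_sum => n _; rewrite /sqnorms normcC.
case: ifP => mn; last by rewrite normr0 expr0n mulr_ge0 ?sqr_ge0// invr_ge0 sqr_ge0.
have q0 : 0 <= m.+1%:R / n.+1%:R :> R by rewrite divr_ge0.
have q1 : m.+1%:R / n.+1%:R <= 1 :> R.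
  by rewrite ler_pdivrMr ?ltr0n// mul1r ler_nat ltnS.
rewrite ger0_norm ?exprn_ge0// -exprVn -exprMn ler_pXn2r ?nnegrE ?exprn_ge0//.
by rewrite -[leRHS]expr1 ler_wiXn2l.
Qed.

(** As inner products, the values at positive integers are limits of convergent
series and linear in the coefficients. *)
Lemma dirichlet_eval_dot f k : (0 < k)%N -> exists x : H2,
  (forall n, x n = (n.+1%:R ^- k : R)%:C) /\
  dirichlet_eval f k%:R = H2dot f x.
Proof.
move=> k0; have [x hx _] := power_vector_exists 0 k0.
have xE n : x n = (n.+1%:R ^- k : R)%:C by rewrite hx leq0n mul1r exprVn.
exists x; split => //; rewrite /dirichlet_eval /H2dot; congr (limn (series _)).
apply/funext => n; rewrite natcpow_negnat xE; congr (_ * _).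
by rewrite conj_real.
Qed.

(** Dirichlet coefficients are read off at large integers: once the
coefficients before [m] vanish, the value at [k] scaled by [m.+1 ^ k] is the
pairing with a vector tending weakly to [deltaH2 R m]. *)
Lemma dirichlet_uniqueness f g :
  (forall s, 1 / 2 < complex.Re s -> dirichlet_eval f s = dirichlet_eval g s) ->
  f = g.
Proof.
move=> fg; apply/eqP; rewrite -subr_eq0; apply/eqP.
move hE : (f - g) => h.
apply: H2_ext => m; elim/ltn_ind: m => m IH.
have /choice[x hx] k : exists x : H2,
    (forall n, x n = ((if (m <= n)%N then (m.+1%:R / n.+1%:R) ^+ k.+1 else 0) : R)%:C)
    /\ l2norm x <= m.+1%:R * 2.
  by have [x] := power_vector_exists m (ltn0Sn k); exists x.
have hx0 k : H2dot h (x k) = 0.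
  have [y [yE ef]] := dirichlet_eval_dot f (ltn0Sn k).
  have [y' [yE' eg]] := dirichlet_eval_dot g (ltn0Sn k).
  have yy : y' = y by apply: H2_ext => n; rewrite yE yE'.
  have hy : H2dot h y = 0.
    rewrite -hE H2dotBl -ef -yy -eg fg ?subrr//.
    have -> : complex.Re (k.+1%:R : R[i]) = k.+1%:R.
      by rewrite -(rmorph_nat (real_complex R)).
    have : 1 <= k.+1%:R :> R by rewrite ler1n.
    lra.
  apply: limc_eq; set u := series _.
  have -> : u = (fun n => ((m.+1%:R ^+ k.+1 : R)%:C : R[i]^o) *
      series (fun n => h n * (y n)^* : R[i]^o) n).
    apply/funext => n; rewrite /u !seriesEnat /= mulr_sumr.
    apply: eq_bigr => i _; rewrite (hx k).1 yE.
    case: leqP => [mi|im]; last by rewrite IH// !mul0r mulr0.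
    rewrite mulrCA; congr (_ * _).
    by rewrite !conj_real expr_div_n rmorphM.
  have := cvgM (cvg_cst ((m.+1%:R ^+ k.+1 : R)%:C : R[i]^o)) (@H2dot_cvg R h y).
  by rewrite hy mulr0; exact.
have wk := @weak_cvg R x (deltaH2 R m) (m.+1%:R * 2) (fun k => (hx k).2).
have : (H2dot (x k) h @[k --> \oo] --> H2dot (deltaH2 R m) h)%classic.
  apply: wk => j; apply/cvgcP => e e0.
  case: (ltngtP j m) => [jm|mj|->].
  - near=> k; rewrite (hx k).1 leqNgt jm /= (ltn_eqF jm) subrr normc0//.
  - have q1 : `|m.+1%:R / j.+1%:R : R| < 1.
      by rewrite ger0_norm ?divr_ge0// ltr_pdivrMr ?ltr0n// mul1r ltr_nat ltnS.
    have /cvgrPdist_lt/(_ e e0)[N _ hN] := cvg_expr q1.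
    exists N => // k /= Nk; rewrite (hx k).1 (ltnW mj) gtn_eqF// sub0r normcN normcC.
    by have := hN k.+1 (leqW Nk); rewrite sub0r normrN.
  - have -> : deltaH2 R m m = 1 by rewrite /= eqxx.
    near=> k; rewrite (hx k).1 leqnn divff ?pnatr_eq0// expr1n subrr normc0//.
under eq_cvg do rewrite H2dotC hx0 conjC0.
move=> c0; have := limc_eq c0; rewrite (@limc_eq R _ 0 (cvg_cst _)).
rewrite H2dotC H2dot_delta => /(congr1 Num.conj).
by rewrite conjCK conjC0.
Unshelve. all: by end_near. Qed.

End DirichletSeries.

Theorem theorem9p4 (R : realType) (c0 : int) (c1 : R[i])
    (hc0 : 2 <= c0) (hc1 : 0 <= complex.Re c1) :
  let phi : R[i] -> R[i] := fun s => c0%:~R * s + c1 in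
  (exists Cphi : bounded_operator (dirichletH2 R),
     is_composition_operator phi Cphi) /\
  (forall Cphi : bounded_operator (dirichletH2 R),
     is_composition_operator phi Cphi ->
     double_commutant_property (@H2dot R) Cphi).
Proof.
case: c0 hc0 => [b|//] b2 phi.
have b1 : (1 < b)%N by exact: b2.
have [C [Cpow Cout Cn]] := composition_operator_exists b1 hc1.
have Cphi : is_composition_operator phi C := composition_eval b1 Cpow Cout.
split=> [|D Dphi]; first by exists C.
have DC f : D f = C f.
  by apply: dirichlet_uniqueness => s hs; rewrite Dphi// Cphi.
apply: (double_commutant b1 (weight_neq0 c1) (normc_weight_anti hc1) (weight0 c1)).
- by move=> f i; rewrite DC Cpow.
- by move=> f j h; rewrite DC Cout.
- by move=> f; rewrite DC.
Qed.
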